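(* Let $f:\mathbb R\to\mathbb R$ be smooth ($\mathcal C^\infty$), having polynomial degeneracy $p_f$, and let $L,M,T>0$. Let $(S_t)_{t\ge0}$ be the semigroup of entropy admissible weak solutions of $u_t+f(u)_x=0$, let $$\mathcal U_{[L,M]}=\{u_0\in\mathbf L^\infty(\mathbb R)\;|\;\mathrm{Supp}(u_0)\subset[-L,L],\ \|u_0\|_{\mathbf L^\infty(\mathbb R)}\le M\},\qquad f'_M=\sup_{|v|\le M}|f'(v)|,$$ and let $\tilde\gamma_{[L,M]}$ be the constant (depending only on $L,M,f$) described in the context. Then for every $\varepsilon>0$ sufficiently small, $$\mathcal H_\varepsilon\left(S_T(\mathcal U_{[L,M]})\,\Big|\,\mathbf L^1(\mathbb R)\right)\le\frac{\Gamma_{[T,L,M,f]}}{\varepsilon^{p_f}}+\log_2\left(\frac{16(L+Tf'_M)M}{\varepsilon}+1\right),$$ where $$\Gamma_{[T,L,M,f]}=2^{2p_f+1}\left[3\log_25+\log_2(5e)\right]\tilde\gamma_{[L,M]}\left(L+T f'_M\right)^{p_f}\left(1+\frac1T\right).$$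
   Context: $\mathcal H_\varepsilon(K|X)=\log_2\mathcal N_\varepsilon(K|X)$, where $\mathcal N_\varepsilon(K|X)$ is the minimal number of open balls of radius $\varepsilon$ with centers in the metric space $X$ needed to cover $K\subseteq X$. $\mathrm{Supp}(u)$ is the essential support. For $u_0\in\mathbf L^1(\mathbb R)\cap\mathbf L^\infty(\mathbb R)$, $S_tu_0=u(t,\cdot)$ denotes the unique entropy admissible (Kruzhkov) weak solution at time $t$ of the Cauchy problem $u_t(t,x)+f(u(t,x))_x=0$ on $(0,\infty)\times\mathbb R$, $u(0,\cdot)=u_0$; $(S_t)$ is an $\mathbf L^1$-contractive semigroup. Polynomial degeneracy: a smooth $f$ has polynomial degeneracy if $I_f=\{u\in\mathbb R\,|\,f''(u)=0\}$ is finite (and nonempty) and for each $w\in I_f$ there is a natural number $p\ge2$ with $f^{(j)}(w)=0$ for all $j\in\{2,\dots,p\}$ and $f^{(p+1)}(w)\ne0$. For $w\in I_f$, $p_w$ is the minimal $p\ge2$ with $f^{(p+1)}(w)\ne0$, and $p_f=\max_{w\in I_f}p_w$. For $\gamma\ge1$, $TV^{1/\gamma}(g,\mathbb R)=\sup\sum_{i=0}^{n-1}|g(x_{i+1})-g(x_i)|^\gamma$, the supremum being over all $n$ and all $x_0<\dots<x_n$ in $\mathbb R$. The constant $\tilde\gamma_{[L,M]}>0$ is a constant depending only on $L,M,f$ such that for all $T>0$ and $u_0\in\mathcal U_{[L,M]}$, $S_Tu_0$ (a suitable representative) satisfies $TV^{1/p_f}(S_Tu_0,\mathbb R)\le\tilde\gamma_{[L,M]}(1+\frac1T)$.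 Such a constant exists by a known regularity theorem of Marconi for scalar conservation laws. ''Sufficiently small'' means $\varepsilon\le\varepsilon_0$ for some $\varepsilon_0>0$ that may depend on $L,M,T,f$. *)

(* Defs.v *)
From HB Require Import structures.
From mathcomp Require Import all_boot all_order all_algebra.
From mathcomp Require Import all_classical all_reals all_analysis.

Set Implicit Arguments.
Unset Strict Implicit.
Unset Printing Implicit Defensive.

Import Order.TTheory GRing.Theory Num.Theory.
Import numFieldNormedType.Exports.

Local Open Scope classical_set_scope.
Local Open Scope ring_scope.

(** * Covering numbers and metric entropy *)

Section metric_entropy.
Context {R : realType} {U : Type}.
Implicit Types (X K : set U) (d : U -> U -> \bar R).

Definition open_ball X d (c : U) (eps : R) : set U :=
  [set v | X v /\ (d c v < eps%:E)%E].

Definition covered_by X d (eps : R) K (n : nat) : Prop :=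
  exists c : 'I_n -> U, (forall i, X (c i)) /\
    K `<=` \bigcup_(i in [set: 'I_n]) open_ball X d (c i) eps.

(* [+oo] when no finite family of balls covers [K]. *)
Definition covering_number X d (eps : R) K : \bar R :=
  ereal_inf [set (n%:R)%:E | n in covered_by X d eps K].

Definition metric_entropy X d (eps : R) K : \bar R :=
  (lne (covering_number X d eps K) * ((ln 2)^-1)%:E)%E.

End metric_entropy.

Definition log2 {R : realType} (x : R) : R := ln x / ln 2.

(** * Lebesgue spaces on the real line *)

Section lebesgue_spaces.
Context {R : realType}.
Local Notation mu := (@lebesgue_measure R).
Implicit Types (u v : R -> R).

(* Elements of [L^p] are represented by functions; [L1_dist] is the distance
   of the classes of its arguments for almost everywhere equality. *)
Definition in_L1 u : Prop := u \in Lfun mu 1%E.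

Definition in_Linfty u : Prop := u \in Lfun mu +oo%E.

Definition L1_dist u v : \bar R := Lnorm mu 1%E (EFin \o (u \- v)).

Definition Linfty_norm u : \bar R := Lnorm mu +oo%E (EFin \o u).

(* Complement of the union of the open sets on which [u] vanishes a.e. *)
Definition ess_support u : set R :=
  ~` \bigcup_(O in [set O : set R | open O /\
                      \forall x \ae mu, O x -> u x = 0]) O.

(* [frac_TV gamma g] is the quantity denoted TV^{1/gamma}(g, R): no root of the
   sum is taken. *)
Definition frac_TV (gamma : R) (g : R -> R) : \bar R :=
  ereal_sup [set s : \bar R | exists (n : nat) (x : nat -> R),
    (forall i, (i < n)%N -> x i < x i.+1) /\
    s = (\sum_(i < n) `|g (x i.+1) - g (x i)| `^ gamma)%:E].

Definition data_class (L M : R) : set (R -> R) :=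
  [set u | [/\ in_Linfty u, ess_support u `<=` `[- L, L]
             & (Linfty_norm u <= M%:E)%E]].

End lebesgue_spaces.

(** * Fluxes with polynomial degeneracy *)

Section flux.
Context {R : realType}.
Implicit Types (f : R -> R).

Definition smooth f : Prop :=
  forall (n : nat) (x : R), derivable (derive1n n f) x 1.

Definition inflection_set f : set R := [set w | derive1n 2 f w = 0].

Definition polynomial_degeneracy f : Prop :=
  [/\ finite_set (inflection_set f), inflection_set f !=set0
    & forall w, inflection_set f w -> exists p : nat, [/\ (2 <= p)%N,
        forall j : nat, (2 <= j <= p)%N -> derive1n j f w = 0
      & derive1n p.+1 f w != 0]].

Definition degeneracy_at f (w : R) : nat :=
  xget 0%N [set p : nat | [/\ (2 <= p)%N, derive1n p.+1 f w != 0 &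
    forall q : nat, (2 <= q)%N -> derive1n q.+1 f w != 0 -> (p <= q)%N]].

Definition degeneracy f : nat :=
  \big[maxn/0%N]_(w \in inflection_set f) degeneracy_at f w.

Definition max_speed f (M : R) : R :=
  sup [set `|derive1 f v| | v in [set v : R | `|v| <= M]].

End flux.

(** * Entropy admissible weak solutions *)

Section entropy_solutions.
Context {R : realType}.
Local Notation mu := (@lebesgue_measure R).

Definition partial_t (phi : R * R -> R) (z : R * R) : R :=
  derive1 (fun t : R => phi (t, z.2)) z.1.

Definition partial_x (phi : R * R -> R) (z : R * R) : R :=
  derive1 (fun x : R => phi (z.1, x)) z.2.

Definition C1 (phi : R * R -> R) : Prop :=
  [/\ forall z : R * R, derivable (fun t : R => phi (t, z.2)) z.1 1,
      forall z : R * R, derivable (fun x : R => phi (z.1, x)) z.2 1,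
      continuous (partial_t phi) & continuous (partial_x phi)].

Definition half_plane : set (R * R) := [set z | 0 < z.1].

(* [C^1] functions with compact support in the open half plane [t > 0]. *)
Definition test_function (phi : R * R -> R) : Prop :=
  [/\ C1 phi, compact (closure [set z | phi z != 0])
    & closure [set z | phi z != 0] `<=` half_plane].

Definition half_plane_integral (F : R * R -> R) : R :=
  (\int[(mu \x mu)%E]_(z in half_plane) F z)%R.

Definition weak_solution (f : R -> R) (u : R -> R -> R) : Prop :=
  forall phi, test_function phi ->
    half_plane_integral (fun z => u z.1 z.2 * partial_t phi z +
                                  f (u z.1 z.2) * partial_x phi z) = 0.

Definition kruzhkov_admissible (f : R -> R) (u : R -> R -> R) : Prop :=
  forall (k : R) phi, test_function phi -> (forall z, 0 <= phi z) ->
    0 <= half_plane_integral (fun z =>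
           `|u z.1 z.2 - k| * partial_t phi z +
           Num.sg (u z.1 z.2 - k) * (f (u z.1 z.2) - f k) * partial_x phi z).

(* [u t] is the profile at time [t >= 0]; bounded solutions in
   [C([0, +oo[; L^1)], for which the value at a given time makes sense. *)
Definition entropy_solution (f : R -> R) (u0 : R -> R) (u : R -> R -> R) :
    Prop :=
  [/\ measurable_fun half_plane (fun z : R * R => u z.1 z.2),
      exists C : R, forall t : R, 0 <= t -> (Linfty_norm (u t) <= C%:E)%E,
      (forall t : R, 0 <= t -> in_L1 (u t)) /\
      (forall t : R, 0 <= t ->
         L1_dist (u s) (u t) @[s --> within [set s : R | 0 <= s] (nbhs t)]
           --> 0%E),
      \forall x \ae mu, u 0 x = u0 x
    & weak_solution f u /\ kruzhkov_admissible f u].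

(* [S t u0] is the entropy solution with initial datum [u0] at time [t]; it is
   determined up to almost everywhere equality. *)
Definition entropy_semigroup (f : R -> R) (S : R -> (R -> R) -> (R -> R)) :
    Prop :=
  forall u0, in_L1 u0 -> in_Linfty u0 ->
    entropy_solution f u0 (fun t => S t u0).

(* [gamma] bounds TV^{1/p_f} of some representative of each [S t u0]. *)
Definition regularity_constant (f : R -> R) (S : R -> (R -> R) -> (R -> R))
    (L M gamma : R) : Prop :=
  0 < gamma /\
  forall (t : R) (u0 : R -> R), 0 < t -> data_class L M u0 ->
    exists g : R -> R, (\forall x \ae mu, g x = S t u0 x) /\
      (frac_TV (degeneracy f)%:R g <= (gamma * (1 + t^-1))%:E)%E.

Definition entropy_constant (f : R -> R) (T L M gamma : R) : R :=
  2 ^+ (2 * degeneracy f + 1) * (3 * log2 5 + log2 (5 * expR 1)) * gamma *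
  (L + T * max_speed f M) ^+ degeneracy f * (1 + T^-1).

End entropy_solutions.

(* Main.v *)
Require Import Defs.
From mathcomp Require Import all_boot all_order all_algebra.
From mathcomp Require Import all_classical all_reals all_analysis.
From mathcomp Require Import measurable_realfun ess_sup_inf.
From mathcomp Require Import zify ring lra.
Import Order.TTheory GRing.Theory Num.Theory.
Import numFieldNormedType.Exports.
Local Open Scope classical_set_scope.
Local Open Scope ring_scope.
Set Implicit Arguments.
Unset Strict Implicit.

(** Testing Kruzhkov's inequality against a C^1 function supported in a backward
cone of slope [c] shows that a nonnegative entropy dominating [1/c] times its
flux, and vanishing initially on an interval, vanishes in the cone over that
interval.  With [|u - M| + |u + M| - 2 M] this is the maximum principle
[|u| <= M]; with [|u|] and [c] slightly above [max_speed f M] it gives that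
[S T u0] vanishes outside [[- l, l]], where [l := L + T * max_speed f M].

Let [p] be the degeneracy and [V] bound TV^{1/p}.  Cut [[- l, l]] into
[n >= V (4 l / eps)^p] cells of equal length.  By the power mean inequality both
the sum of the oscillations on the cells and the sum of the jumps between
consecutive cells are at most [n * eps / (4 l)].  Hence the step function with
values rounded to multiples of [eps / (8 l)] is [eps]-close in L^1, and its
integer levels, starting from 0, have total variation at most [3 n].  Such
a sequence of levels is spelled by a word of length [4 n] over three letters,
whence [81 ^ n] balls suffice, with [n <= 2 V (4 l / eps)^p]. *)

(** The cone argument is run twice because the speed over [[- M, M]] governs the solution only once
    its values are known to stay there, while an entropy solution comes merely with some bound. In
    the first run any finite slope will do: the datum is bounded by [M] on the whole line, and the
    cones over []- n, n[] exhaust it. Test functions live in [t > 0], whence a cutoff in time; the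
    datum has to enter through continuity in L^1 at time 0. The same continuity is used at the final
    time, since an integral inequality over the half plane says nothing about an individual time.

    A level sequence has no useful bound cell by cell, only one on its total variation. Spelling it
    as a word turns this into a length, so that the count is a plain power and no binomial estimate
    is needed. The first level is reached from 0 because the profile vanishes to the left of [- l];
    hence no starting level has to be counted separately. *)

(** * Counting level sequences *)

(* [Some true] and [Some false] move the current level up and down, [None] emits
   it: a sequence of levels costs its length plus its total variation. *)
Fixpoint decode (k : int) (w : seq (option bool)) : seq int :=
  match w with
  | [::] => [::]
  | Some b :: w' => decode (if b then k + 1 else k - 1) w'
  | None :: w' => k :: decode k w'
  end.

Fixpoint travel (k : int) (ks : seq int) : nat :=
  if ks is a :: ks' then (`|a - k| + travel a ks')%N else 0%N.

Lemma decode_move (k d : int) : exists s : seq (option bool),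
  size s = `|d|%N /\ forall w, decode k (s ++ w) = decode (k + d) w.
Proof.
have [n [->|->]] : exists n : nat, d = n%:Z \/ d = - n%:Z.
  by exists `|d|%N; lia.
- exists (nseq n (Some true)); split; first by rewrite size_nseq; lia.
  move=> w; elim: n k => [|n ih] k /=; first by rewrite addr0.
  by rewrite ih; congr decode; lia.
- exists (nseq n (Some false)); split; first by rewrite size_nseq; lia.
  move=> w; elim: n k => [|n ih] k /=; first by rewrite oppr0 addr0.
  by rewrite ih; congr decode; lia.
Qed.

(** The suffix [r] is left free so that the word can be padded afterwards. *)
Lemma decode_encode (k : int) (ks : seq int) : exists w : seq (option bool),
  size w = (size ks + travel k ks)%N /\
  forall r, decode k (w ++ r) = ks ++ decode (last k ks) r.
Proof.
elim: ks k => [|a ks ih] k /=; first by exists [::].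
have [w [sw dw]] := ih a; have [s [ss ds]] := decode_move k (a - k).
exists (s ++ None :: w); split; first by rewrite size_cat /= ss sw; lia.
move=> r; rewrite -catA ds /= addrC subrK.
by rewrite dw.
Qed.

Lemma decode_surj (k : int) (ks : seq int) (m : nat) :
  (size ks + travel k ks <= m)%N ->
  exists w : m.-tuple (option bool), decode k w = ks.
Proof.
move=> le_m; have [w [sw dw]] := decode_encode k ks.
(* Padding by moves emits nothing, so all words can be given the same length [m]. *)
set r := nseq (m - size w) (Some true).
have sz : size (w ++ r) == m by rewrite size_cat size_nseq; apply/eqP; lia.
exists (Tuple sz); rewrite /= dw -[RHS]cats0; congr (_ ++ _).
by rewrite /r; elim: (m - size w)%N (last k ks) => //= n ih k'.
Qed.

(** * Covering numbers and metric entropy *)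

Lemma covered_by_fin (R : realType) (U : Type) (X : set U)
    (d : U -> U -> \bar R) (eps : R) (K : set U) (I : finType) (c : I -> U) :
  (forall i, X (c i)) ->
  (forall v, K v -> X v /\ exists i, (d (c i) v < eps%:E)%E) ->
  Defs.covered_by X d eps K #|I|.
Proof.
move=> Xc Kc; exists (fun i => c (enum_val i)); split => // v Kv.
have [Xv [i iv]] := Kc v Kv.
by exists (enum_rank i) => //; split; rewrite ?enum_rankK.
Qed.

Lemma metric_entropy_le (R : realType) (U : Type) (X : set U)
    (d : U -> U -> \bar R) (eps B : R) (K : set U) (N : nat) :
  (0 < N)%N -> Defs.covered_by X d eps K N -> log2 (N%:R : R) <= B ->
  (metric_entropy X d eps K <= B%:E)%E.
Proof.
move=> N0 cN NB; rewrite /metric_entropy.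
have ln2 : 0 < ln (2 : R) by rewrite ln_gt0 // ltr1n.
have N0R : 0 < (N%:R : R) by rewrite ltr0n.
apply: (@le_trans _ _ (lne (N%:R)%:E * ((ln 2)^-1)%:E)%E); last first.
  by rewrite lne_EFin // -EFinM lee_fin.
apply: lee_wpmul2r; first by rewrite lee_fin invr_ge0 ltW.
have cov0 : (0 <= covering_number X d eps K)%E.
  by apply: le_ereal_inf_tmp => _ [n _ <-]; rewrite lee_fin.
rewrite lee_lne ?in_itv /= ?leey ?andbT //.
by apply: ereal_inf_lbound; exists N.
Qed.

(** * Power means and fractional variation *)

(** AM-GM for one [a ^+ p.+1] and [p] copies of [b ^+ p.+1]. In the induction, the new difference is
    [a] times the old one plus the nonnegative term [p.+1 * b ^+ p * (a - b) ^+ 2]. *)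
Lemma young_exprn (R : realType) (p : nat) (a b : R) : 0 <= a -> 0 <= b ->
  p.+1%:R * a * b ^+ p <= a ^+ p.+1 + p%:R * b ^+ p.+1.
Proof.
move=> a0 b0; elim: p => [|p ih]; first by rewrite !expr0 !expr1 mul0r; lra.
have bp : 0 <= b ^+ p by exact: exprn_ge0.
have h1 := ler_wpM2l a0 ih.
have h2 : 0 <= p.+1%:R * b ^+ p * (a - b) ^+ 2.
  by rewrite mulr_ge0 ?sqr_ge0 // mulr_ge0.
rewrite -(natr1 p.+1) -subr_ge0.
move: h1 h2; rewrite -subr_ge0 -(natr1 p) !exprS expr0 => h1 h2.
rewrite (_ : _ - _ = (a * (a * a ^+ p + p%:R * (b * b ^+ p)) -
  a * ((p%:R + 1) * a * b ^+ p)) + (p%:R + 1) * b ^+ p * ((a - b) * ((a - b) * 1))).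
  exact: addr_ge0.
ring.
Qed.

(** Prescribing the mean [b] avoids roots: [young_exprn] summed over [i] bounds [p.+1 * b ^+ p]
    times the sum of the [a i] by [p.+1 * n * b ^+ p.+1], and the common factor cancels. *)
Lemma sum_le_of_sum_exprn (R : realType) (p n : nat) (a : 'I_n -> R) (b : R) :
  0 < b -> (forall i, 0 <= a i) ->
  \sum_i a i ^+ p.+1 <= n%:R * b ^+ p.+1 -> \sum_i a i <= n%:R * b.
Proof.
move=> b0 a0 h.
have bp : 0 < b ^+ p by exact: exprn_gt0.
have c0 : 0 < p.+1%:R * b ^+ p by rewrite mulr_gt0.
rewrite -(ler_pM2l c0) mulr_sumr.
apply: (@le_trans _ _ (\sum_i (a i ^+ p.+1 + p%:R * b ^+ p.+1))).
  apply: ler_sum => i _; rewrite mulrAC; apply: young_exprn => //; exact: ltW.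
rewrite big_split /= sumr_const card_ord -[X in _ + X <= _]mulr_natl.
apply: (@le_trans _ _ (n%:R * b ^+ p.+1 + n%:R * (p%:R * b ^+ p.+1))).
  by rewrite lerD2r.
by rewrite -(natr1 p) exprS le_eqVlt; apply/orP; left; apply/eqP; ring.
Qed.

(** The points interlace into one chain [a 0 < b 0 < a 1 < b 1 < ...]; the jumps from [b j] to
    [a j.+1] only add nonnegative terms. *)
Lemma sum_pairs_le_frac_TV (R : realType) (p n : nat) (g : R -> R) (V : R)
    (a b : nat -> R) :
  (forall j, (j < n)%N -> a j < b j) ->
  (forall j, (j < n)%N -> b j < a j.+1) ->
  (frac_TV p%:R g <= V%:E)%E ->
  \sum_(j < n) `|g (b j) - g (a j)| ^+ p <= V.
Proof.
move=> ab ba gV; rewrite -lee_fin; apply: le_trans gV.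
pose x i := if odd i then b i./2 else a i./2.
apply: le_trans (ereal_sup_ubound _); last first.
  exists n.*2, x; split; last by [].
  move=> i; rewrite /x /= uphalf_half; case: ifP => /= oi lin.
    by apply: ba; lia.
  by apply: ab; lia.
have xe j : x j.*2 = a j by rewrite /x odd_double doubleK.
have xo j : x j.*2.+1 = b j by rewrite /x /= odd_double uphalf_double.
rewrite lee_fin.
have -> : \sum_(i < n.*2) `|g (x i.+1) - g (x i)| `^ p%:R =
  \sum_(j < n) (`|g (b j) - g (a j)| ^+ p + `|g (a j.+1) - g (b j)| ^+ p).
  clear ab ba; elim: n => [|n ih]; first by rewrite !big_ord0.
  rewrite doubleS !big_ord_recr /= ih -addrA; congr (_ + _).
  by rewrite !powR_mulrn // -doubleS !xe xo.
apply: ler_sum => j _; rewrite lerDl; exact: exprn_ge0.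
Qed.

Lemma sum_chain_le_frac_TV (R : realType) (p n : nat) (g : R -> R) (V : R)
    (x : nat -> R) :
  (forall i, (i < n)%N -> x i < x i.+1) ->
  (frac_TV p%:R g <= V%:E)%E ->
  \sum_(j < n) `|g (x j.+1) - g (x j)| ^+ p <= V.
Proof.
move=> xi gV; rewrite -lee_fin; apply: le_trans gV.
apply: ereal_sup_ubound; exists n, x; split => //.
by congr EFin; apply: eq_bigr => i _; rewrite powR_mulrn.
Qed.

Section almost_everywhere_lemmas.
Context {d : measure_display} {T : measurableType d} {R : realType}.
Context (mu : {measure set T -> \bar R}).

Lemma ae_imp (P Q : T -> Prop) :
  (\forall x \ae mu, P x) -> (forall x, P x -> Q x) -> \forall x \ae mu, Q x.
Proof. by move=> aP PQ; apply: filterS aP. Qed.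

Lemma ae_imp2 (P Q S : T -> Prop) :
  (\forall x \ae mu, P x) -> (\forall x \ae mu, Q x) ->
  (forall x, P x -> Q x -> S x) -> \forall x \ae mu, S x.
Proof. by move=> aP aQ PQS; apply: filterS2 aP aQ. Qed.

End almost_everywhere_lemmas.

(** * Approximation by step functions *)

Section step_functions.
Context {R : realType}.
Local Notation mu := (@lebesgue_measure R).
Implicit Types (l h del : R) (n : nat) (ks : seq int) (g v : R -> R).

Definition cell l h (j : nat) : set R := `[- l + h * j%:R, - l + h * j.+1%:R[.

(** Levels past the end of [ks] are read as 0, so every word names a step function, whatever number
    of levels it emits. *)
Definition step_fun l h del n ks (x : R) : R :=
  \sum_(j < n) del * (ks`_j)%:~R * \1_(cell l h j) x.

Lemma measurable_cell l h j : measurable (cell l h j).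
Proof. exact: measurable_itv. Qed.

Lemma sum_cells l h n (x : R) : 0 <= h ->
  \sum_(j < n) \1_(cell l h j) x = \1_(`[- l, - l + h * n%:R[) x :> R.
Proof.
move=> h0; elim: n => [|n ih].
  by rewrite big_ord0 mulr0 addr0 set_itvco0 indic0.
rewrite big_ord_recr /= ih !indicE !mem_setE !in_itv /=.
have hn : 0 <= h * n%:R by rewrite mulr_ge0.
rewrite -natr1 mulrDr mulr1.
have [h1|h1] := leP (- l) x; have [h2|h2] := ltP x (- l + h * n%:R);
  have [h3|h3] := ltP x (- l + (h * n%:R + h)); rewrite /= ?add0r ?addr0 //; lra.
Qed.

Lemma in_L1P v : in_L1 v <-> mu.-integrable setT (EFin \o v).
Proof. by split=> /Lfun1_integrable. Qed.

Lemma in_L1_measurable v : in_L1 v -> measurable_fun setT v.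
Proof. by move=> /in_L1P /measurable_int /measurable_EFinP. Qed.

Lemma integrable_step l h n (e : 'I_n -> R) :
  mu.-integrable setT (fun x => (\sum_(j < n) e j * \1_(cell l h j) x)%:E).
Proof.
rewrite (_ : (fun _ => _) =
    (fun x => \sum_(j < n) ((e j)%:E * (\1_(cell l h j) x)%:E))%E); last first.
  by apply/funext => x; rewrite -sumEFin.
apply: integrable_sum => // j _.
by apply: integrableZl => //; exact: integrable_indic_itv.
Qed.

Lemma step_fun_L1 l h del n ks : in_L1 (step_fun l h del n ks).
Proof. by apply/in_L1P; exact: integrable_step. Qed.

Lemma integral_step l h n (e : 'I_n -> R) : 0 <= h ->
  (\int[mu]_x (\sum_(j < n) e j * \1_(cell l h j) x)%:E =
   (\sum_(j < n) e j * h)%:E)%E.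
Proof.
move=> h0.
transitivity (\int[mu]_x (\sum_(j < n) ((e j)%:E * (\1_(cell l h j) x)%:E)))%E.
  by apply: eq_integral => x _; rewrite -sumEFin.
have ic j : mu.-integrable setT (fun x => (\1_(cell l h j) x)%:E).
  exact: integrable_indic_itv.
rewrite integral_sum //; last first.
  by move=> j; apply: integrableZl => //; exact: ic.
rewrite -sumEFin; apply: eq_bigr => j _.
rewrite (@integralZl _ _ _ mu _ measurableT _ (ic j)) EFinM; congr (_ * _)%E.
rewrite integral_indic ?setIT //; last exact: measurable_cell.
etransitivity.
  exact: (lebesgue_measure_itv `[- l + h * j%:R, - l + h * j.+1%:R[%R).
rewrite /= lte_fin -natr1 mulrDr mulr1 addrA ltrDl.
case: ltP => h1; first by rewrite -EFinB; congr EFin; ring.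
by congr EFin; apply/eqP; rewrite eq_le h0.
Qed.

Lemma L1_dist_step_le l h del n ks v (e : 'I_n -> R) :
  0 <= h -> measurable_fun setT v -> (forall j, 0 <= e j) ->
  (\forall x \ae mu, ~ (`[- l, - l + h * n%:R[%classic x) -> v x = 0) ->
  (\forall x \ae mu, forall j : 'I_n, cell l h j x ->
     `|del * (ks`_j)%:~R - v x| <= e j) ->
  (L1_dist (step_fun l h del n ks) v <= (\sum_(j < n) e j * h)%:E)%E.
Proof.
move=> h0 mv e0 v0 ve; rewrite /L1_dist Lnorm1 -(@integral_step l h n e) //.
have ms := in_L1_measurable (step_fun_L1 l h del n ks).
have mi := @integrable_step l h n e.
apply: ae_ge0_le_integral => //.
- by apply/measurable_EFinP; apply: measurableT_comp => //; exact: measurable_funB.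
- move=> x _; rewrite lee_fin sumr_ge0 // => j _.
  by rewrite mulr_ge0 // indicE.
- exact: measurable_int mi.
apply: (ae_imp2 v0 ve) => x {}v0 {}ve _; rewrite /= lee_fin.
(* Off the cells [v] vanishes, so it splits along their indicators just as the step function
   does. *)
have -> : v x = \sum_(j < n) v x * \1_(cell l h j) x.
  rewrite -mulr_sumr sum_cells // indicE.
  by case: (boolP (x \in _)) => [|/negP]; rewrite ?mulr1 // inE => /v0 ->; rewrite mul0r.
rewrite /step_fun -sumrB; apply: le_trans (ler_norm_sum _ _ _) _.
apply: ler_sum => j _; rewrite -mulrBl normrM [X in _ * X]ger0_norm ?indicE //.
case: (boolP (x \in cell l h j)) => [xj|]; last by rewrite !mulr0.
by rewrite !mulr1; apply: ve; rewrite inE in xj.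
Qed.

(** A crude bound whose only purpose is to make suprema over cells finite: [r ^+ p.+1 <= V] forces
    [r <= 1] or [r <= V]. *)
Lemma frac_TV_dist_le p g (V x y : R) : (frac_TV p.+1%:R g <= V%:E)%E ->
  `|g x - g y| <= 1 + V.
Proof.
wlog xy : x y / y < x => [hw gV|gV].
  have [->|] := eqVneq x y; last first.
    by rewrite neq_lt => /orP[|] ?; [rewrite distrC|]; exact: hw.
  rewrite subrr normr0 addr_ge0 //.
  (* The empty chain gives [0 <= V]. *)
  by have := @sum_chain_le_frac_TV R p.+1 0 g V (fun=> 0); rewrite big_ord0; apply.
have := @sum_chain_le_frac_TV R p.+1 1 g V (fun i => if i == 0%N then y else x).
rewrite big_ord_recl big_ord0 addr0 /= => h.
have {}h : `|g x - g y| ^+ p.+1 <= V by apply: h => // -[|].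
have [h1|/ltW h1] := leP (`|g x - g y|) 1.
  by apply: (le_trans h1); rewrite lerDl (le_trans _ h) // exprn_ge0.
apply: (@le_trans _ _ V); last by rewrite lerDr.
by apply: le_trans h; exact: ler_eXnr.
Qed.

(** [g] need not attain its oscillation on a cell; a point that nearly does is enough, at the price
    of a slack [eta]. *)
Lemma near_max (A : set R) (F : R -> R) (B eta : R) : A !=set0 -> 0 < eta ->
  (forall x, A x -> F x <= B) -> exists2 y, A y & forall x, A x -> F x <= F y + eta.
Proof.
move=> [a Aa] eta0 FB.
have hs : has_sup (F @` A).
  by split; [exists (F a); exists a | exists B => _ [x Ax <-]; exact: FB].
have [_ [y Ay <-] h] := sup_adherent eta0 hs.
exists y => // x Ax; have : F x <= sup (F @` A) by apply: sup_upper_bound => //; exists x.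
lra.
Qed.

Lemma travel_mkseq (k0 : int) (k : nat -> int) n :
  travel k0 [seq k j | j <- iota 0 n] =
  \sum_(j < n) `|k j - (if j == 0%N :> nat then k0 else k j.-1)|%N.
Proof.
suff H m : travel (if m == 0%N :> nat then k0 else k m.-1) [seq k j | j <- iota m n] =
    \sum_(j < n) `|k (m + j)%N - (if (m + j)%N == 0%N then k0 else k (m + j).-1)|%N.
  exact: (H 0%N).
elim: n m => [|n ih] m /=; first by rewrite big_ord0.
rewrite big_ord_recl /= addn0 (ih m.+1); congr (_ + _)%N.
by apply: eq_bigr => j _; rewrite /bump /= addnA addn1 addSn.
Qed.

(** Both sums have mean at most [lam = 2 * del]. Measured in units of [del], the jumps cost [2 * n],
    and rounding adds one unit per cell: this is the travel [3 * n]. The point [x0] supplies a value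
    0 of [g] before the first cell. *)
Lemma frac_TV_step_approx p n g v (V l eps x0 : R) :
  0 < l -> 0 < eps -> (0 < n)%N ->
  V <= n%:R * (eps / (4 * l)) ^+ p.+1 ->
  (frac_TV p.+1%:R g <= V%:E)%E ->
  measurable_fun setT v -> (\forall x \ae mu, g x = v x) ->
  (\forall x \ae mu, ~ (`[- l, l[%classic x) -> v x = 0) ->
  x0 < - l -> g x0 = 0 ->
  exists2 ks : seq int, size ks = n /\ (travel 0 ks <= 3 * n)%N &
   (L1_dist (step_fun l (2 * l / n%:R) (eps / (8 * l)) n ks) v < eps%:E)%E.
Proof.
move=> l0 eps0 n0 Vn gV mv gv v0 x0l gx0.
set lam := eps / (4 * l) in Vn *; set del := eps / (8 * l); set h := 2 * l / n%:R.
have n0R : 0 < (n%:R : R) by rewrite ltr0n.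
have lam0 : 0 < lam by rewrite divr_gt0 // mulr_gt0.
have del0 : 0 < del by rewrite divr_gt0 // mulr_gt0.
have lamdel : lam = 2 * del by rewrite /lam /del; field; lra.
have h0 : 0 < h by rewrite divr_gt0 // mulr_gt0.
have hn : h * n%:R = 2 * l by rewrite /h divfK // lt0r_neq0.
have ldel : l * del = eps / 8 by rewrite /del; field; lra.
pose y (j : nat) := - l + h * j%:R.
have yS j : y j.+1 = y j + h by rewrite /y -natr1 mulrDr mulr1 addrA.
have ylt j : y j < y j.+1 by rewrite yS ltrDl.
(* The cell is taken open because the points [y j < x j < y j.+1] have to form a strictly increasing
   chain; the left end itself is the reference value. *)
pose A j := `]y j, y j.+1[%classic.
have hx j : { x | A j x & forall z, A j z ->
    `|g z - g (y j)| <= `|g x - g (y j)| + del / 2 }.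
  apply: cid2; apply: (@near_max (A j) (fun z => `|g z - g (y j)|) (1 + V)).
  - exists (y j + h / 2); rewrite /A /= in_itv /= yS; lra.
  - lra.
  - by move=> z _; exact: (@frac_TV_dist_le p).
pose x j := s2val (hx j).
have xA j : A j (x j) := s2valP (hx j).
have xmax j := s2valP' (hx j).
have xin j : y j < x j < y j.+1 by have := xA j; rewrite /A /= in_itv.
pose a (j : 'I_n) := `|g (x j) - g (y j)|.
have sa : \sum_j a j <= n%:R * lam.
  apply: (@sum_le_of_sum_exprn R p) => [//|j|]; first exact: normr_ge0.
  apply: le_trans Vn.
  by apply: (@sum_pairs_le_frac_TV R p.+1 n g V y x) => // j _;
    have /andP[] := xin j.
pose k j : int := Num.floor (g (y j) / del).
have kP j : `|del * (k j)%:~R - g (y j)| <= del.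
  have := floor_itv (g (y j) / del); rewrite -/(k j).
  rewrite ler_pdivlMr // ltr_pdivrMr // intrD ler_norml => /andP[h1 h2].
  by apply/andP; split; lra.
(* The left ends preceded by [x0]: the first jump is the climb from level 0. *)
pose z i := if i == 0%N then x0 else y i.-1.
have sz : \sum_(j < n) `|g (z j.+1) - g (z j)| <= n%:R * lam.
  apply: (@sum_le_of_sum_exprn R p) => [//|j|]; first exact: normr_ge0.
  apply: le_trans Vn; apply: (@sum_chain_le_frac_TV R p.+1 n g V z) => // -[|i] _.
    by rewrite /z /= /y mulr0 addr0.
  exact: ylt.
exists [seq k j | j <- iota 0 n]; first split.
- by rewrite size_map size_iota.
- rewrite travel_mkseq -(ler_nat R) natr_sum.
  apply: (@le_trans _ _ (\sum_(j < n) (`|g (z j.+1) - g (z j)| / del + 1))).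
    (* Floors of [s] and [t] differ by at most [|s - t| + 1]. *)
    apply: ler_sum => j _; rewrite natr_absz.
    pose k' : int := if j == 0%N :> nat then 0 else k j.-1.
    have kz : k' = Num.floor (g (z j) / del).
      by rewrite /k' /z; case: ifP => //; rewrite gx0 mul0r floor0.
    rewrite -/k' kz /z /= -/(k j).
    set s := g (y j) / del; set t := g _ / del.
    have -> : `|g (y j) - g (if j == 0%N :> nat then x0 else y j.-1)| / del = `|s - t|.
      by rewrite /s /t -mulrBl normrM (gtr0_norm (_ : 0 < del^-1)) // invr_gt0.
    rewrite /k -/s; have := floor_itv s; have := floor_itv t.
    rewrite !intrD => /andP[t1 t2] /andP[s1 s2].
    rewrite intr_norm intrB ler_norml.
    by case: (ger0P (s - t)) => st; apply/andP; split; lra.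
  rewrite big_split /= sumr_const card_ord -mulr_suml natrM.
  have : (\sum_(j < n) `|g (z j.+1) - g (z j)|) / del <= n%:R * 2.
    by rewrite ler_pdivrMr // -mulrA -lamdel.
  lra.
have ksE (j : 'I_n) : [seq k j | j <- iota 0 n]`_j = k j.
  by rewrite (nth_map 0%N) ?size_iota // nth_iota.
(* Error on a cell: the nearly attained oscillation [a j], its slack [del / 2], and the rounding
   [del]. *)
apply: (@le_lt_trans _ _ (\sum_(j < n) (a j + del / 2 + del) * h)%:E).
  apply: L1_dist_step_le => //; first exact: ltW.
  - by move=> j; have : 0 <= a j; [exact: normr_ge0|lra].
  - by rewrite hn (_ : - l + 2 * l = l) //; lra.
  apply: (ae_imp gv) => t gt j; rewrite ksE -gt => tj.
  apply: le_trans (ler_distD (g (y j)) _ _) _; rewrite addrC.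
  apply: lerD; last exact: kP.
  move: tj; rewrite /cell /= in_itv /= -/(y j) -/(y j.+1) => /andP[].
  rewrite le_eqVlt => /orP[/eqP<- _|yt ty].
    by rewrite subrr normr0; have : 0 <= a j; [exact: normr_ge0|lra].
  by rewrite distrC; apply: xmax; rewrite /A /= in_itv /= yt ty.
rewrite lte_fin -mulr_suml !big_split /= !sumr_const !card_ord.
rewrite -[X in _ + X + _]mulr_natl -[X in _ + X]mulr_natl.
apply: (@le_lt_trans _ _ ((n%:R * lam + n%:R * (del / 2) + n%:R * del) * h)).
  by apply: ler_wpM2r; [exact: ltW|rewrite !lerD2r].
rewrite -!mulrDr [_ * h]mulrC mulrA hn lamdel.
clear - ldel eps0; move: ldel; move: del => del ldel.
(* The total error is [7 * (l * del)], that is [7 / 8] of [eps], which is strictly less than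
   [eps]. *)
have -> : 2 * l * (2 * del + del / 2 + del) = 7 * (l * del) by field.
by rewrite ldel; lra.
Qed.

End step_functions.

(** * Test functions supported in a cone *)

Section test_functions.
Context {R : realType}.
Implicit Types (s t x : R).

Definition posp s : R := Num.max s 0.

(** The squared positive part is C^1, which the positive part is not; all cutoffs are built from
    it. *)
Definition sqpos s : R := posp s ^+ 2.

Lemma posp_ge0 s : 0 <= posp s.
Proof. by rewrite /posp le_max lexx orbT. Qed.

Lemma posp0 s : s <= 0 -> posp s = 0.
Proof. by move=> s0; rewrite /posp max_r. Qed.

Lemma pospE s : 0 <= s -> posp s = s.
Proof. by move=> s0; rewrite /posp max_l. Qed.

Lemma sqpos0 s : s <= 0 -> sqpos s = 0.
Proof. by move=> s0; rewrite /sqpos posp0 // expr0n. Qed.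

(** A quadratic remainder lets piecewise formulas be differentiated by case analysis on
    inequalities, with no gluing of one-sided derivatives. *)
Lemma is_derive_quadratic (F : R -> R) x (d K : R) :
  (forall h, `|F (h + x) - F x - d * h| <= K * h ^+ 2) -> is_derive x 1 F d.
Proof.
move=> FK.
have K0 : 0 <= K by apply: le_trans (_ : K * 1 ^+ 2 <= K); rewrite ?(le_trans _ (FK 1)) // expr1n mulr1.
have cF : h^-1 *: (F (h *: 1 + x) - F x) @[h --> 0^'] --> d.
  apply/cvgrPdist_le => e e0; near=> h.
  have h0 : h != 0 by near: h; exact: nbhs_dnbhs_neq.
  have he : `|h| <= e / (K + 1).
    near: h; apply: dnbhs0_le; rewrite divr_gt0 //; lra.
  rewrite /GRing.scale /= mulr1.
  have -> : d - h^-1 * (F (h + x) - F x) = - (h^-1 * (F (h + x) - F x - d * h)).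
    by field.
  rewrite normrN normrM normfV.
  have h1 : 0 < `|h| by rewrite normr_gt0.
  rewrite mulrC ler_pdivrMr //; apply: (le_trans (FK h)).
  rewrite -(real_normK (num_real h)) expr2 mulrA ler_wpM2r //.
  move: he; rewrite ler_pdivlMr; last lra.
  move: (normr_ge0 h); move: `|h| => r r0 re.
  by rewrite mulrC; nra.
split; first by apply/cvg_ex; exists d.
exact: cvg_lim cF.
Unshelve. all: by end_near.
Qed.

Lemma is_derive_sqpos s : is_derive s 1 sqpos (2 * posp s).
Proof.
apply: (@is_derive_quadratic _ _ _ 1) => h; rewrite mul1r /sqpos /posp.
case: (leP s 0) => s0; case: (leP (h + s) 0) => hs; rewrite ler_norml;
  apply/andP; split; nra.
Qed.

Lemma continuous_posp : continuous posp.
Proof.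
move=> x; rewrite /posp; apply: (@continuous_max _ _ id (fun=> 0)).
  exact: cvg_id.
exact: cvg_cst.
Qed.

(* A C^1 step from 0 to 1 across [dl, 2 dl]. *)
Definition ramp (dl t : R) : R :=
  (2 * sqpos (t - dl) - 4 * sqpos (t - 3 / 2 * dl) + 2 * sqpos (t - 2 * dl)) / dl ^+ 2.

(** A tent over [[dl, 2 dl]] of height [2 / dl], hence of integral 1. *)
Definition dramp (dl t : R) : R :=
  (4 * posp (t - dl) - 8 * posp (t - 3 / 2 * dl) + 4 * posp (t - 2 * dl)) / dl ^+ 2.

Lemma ramp_bounds (dl t : R) : 0 < dl -> 0 <= ramp dl t <= 1.
Proof.
move=> d0; have d2 : 0 < dl ^+ 2 by exact: exprn_gt0.
rewrite /ramp ler_pdivlMr // ler_pdivrMr // mul0r mul1r /sqpos /posp.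
case: (leP (t - dl) 0) => h1; case: (leP (t - 3 / 2 * dl) 0) => h2;
  case: (leP (t - 2 * dl) 0) => h3; apply/andP; split; nra.
Qed.

Lemma ramp0 (dl t : R) : 0 < dl -> t <= dl -> ramp dl t = 0.
Proof. by move=> d0 td; rewrite /ramp !sqpos0 ?mulr0 ?subr0 ?addr0 ?mul0r //; lra. Qed.

Lemma dramp0 (dl t : R) : 0 < dl -> t <= dl -> dramp dl t = 0.
Proof. by move=> d0 td; rewrite /dramp !posp0 ?mulr0 ?subr0 ?addr0 ?mul0r //; lra. Qed.

Lemma ramp1 (dl t : R) : 0 < dl -> 2 * dl <= t -> ramp dl t = 1.
Proof.
move=> d0 td; have d2 : 0 < dl ^+ 2 by exact: exprn_gt0.
rewrite /ramp /sqpos !pospE; [field|..]; lra.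
Qed.

Lemma dramp_bounds (dl t : R) : 0 < dl -> 0 <= dramp dl t <= 2 / dl.
Proof.
move=> d0; have d2 : 0 < dl ^+ 2 by exact: exprn_gt0.
have -> : 2 / dl = 2 * dl / dl ^+ 2 by field; lra.
rewrite /dramp ler_pM2r ?invr_gt0 // divr_ge0 ?(ltW d2) ?andTb /posp.
all: by case: (leP (t - dl) 0) => h1; case: (leP (t - 3 / 2 * dl) 0) => h2;
  case: (leP (t - 2 * dl) 0) => h3; lra.
Qed.

Lemma dramp_out (dl t : R) : 0 < dl -> 2 * dl <= t -> dramp dl t = 0.
Proof.
move=> d0 td; rewrite /dramp !pospE; [|lra..].
by rewrite (_ : _ + _ = 0) ?mul0r //; lra.
Qed.

Lemma is_derive_affine (F : R -> R) (k m t dF : R) :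
  is_derive (m + k * t) 1 F dF -> is_derive t 1 (fun s => F (m + k * s)) (k * dF).
Proof.
move=> dFP.
have dg : is_derive t 1 (fun s => m + k * s) k.
  apply: (@is_derive_quadratic _ _ _ 0) => h.
  by rewrite mul0r (_ : _ - _ - _ = 0) ?normr0 //; ring.
have := @is_derive1_comp R F (fun s => m + k * s) t dF k dFP dg.
by rewrite mulrC.
Qed.

Lemma is_derive_ramp (dl t : R) : 0 < dl -> is_derive t 1 (ramp dl) (dramp dl t).
Proof.
move=> d0; have sh (m : R) : is_derive t 1 (fun s => sqpos (- m + 1 * s)) (1 * (2 * posp (t - m))).
  by apply: is_derive_affine; rewrite mul1r addrC; exact: is_derive_sqpos.
pose F := (dl ^- 2) \*: ((2 \*: (fun s => sqpos (- dl + 1 * s))) -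
   (4 \*: (fun s => sqpos (- (3 / 2 * dl) + 1 * s))) +
   (2 \*: (fun s => sqpos (- (2 * dl) + 1 * s)))) : R -> R.
have -> : ramp dl = F.
  apply/funext => s; rewrite /ramp /F.
  rewrite !fctE /= /GRing.scale /= mulrC !mul1r.
  by rewrite ![_ + s]addrC.
apply: is_derive_eq; rewrite /GRing.scale /= /dramp; field; lra.
Qed.

End test_functions.

Section cone_test_function.
Context {R : realType}.
Variables (a b c dl : R).
Hypotheses (c_gt0 : 0 < c) (dl_gt0 : 0 < dl).
Implicit Types (z : R * R).

Definition cone_l z : R := posp (z.2 - a - c * z.1).

Definition cone_r z : R := posp (b - c * z.1 - z.2).

(** The factors measure the horizontal distances to the lateral sides [x = a + c t] and
    [x = b - c t], squared for smoothness; the ramp keeps the support away from [t = 0]. *)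
Definition cone_fun z : R := ramp dl z.1 * cone_l z ^+ 2 * cone_r z ^+ 2.

Definition cone_dt z : R := dramp dl z.1 * (cone_l z ^+ 2 * cone_r z ^+ 2) -
  c * ramp dl z.1 * (2 * cone_l z * cone_r z ^+ 2 + 2 * cone_l z ^+ 2 * cone_r z).

Definition cone_dx z : R :=
  ramp dl z.1 * (2 * cone_l z * cone_r z ^+ 2 - 2 * cone_l z ^+ 2 * cone_r z).

Lemma is_derive_cone_dt z :
  is_derive z.1 1 (fun t => cone_fun (t, z.2)) (cone_dt z).
Proof.
case: z => t x /=.
have dL : is_derive t 1 (fun s => sqpos ((x - a) + (- c) * s)) (- c * (2 * cone_l (t, x))).
  apply: is_derive_affine; rewrite /cone_l /= -mulNr; exact: is_derive_sqpos.
have dR : is_derive t 1 (fun s => sqpos ((b - x) + (- c) * s)) (- c * (2 * cone_r (t, x))).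
  apply: is_derive_affine; rewrite /cone_r /= addrAC -mulNr; exact: is_derive_sqpos.
have dX := is_derive_ramp t dl_gt0.
pose F := ramp dl * (fun s => sqpos ((x - a) + (- c) * s)) *
          (fun s => sqpos ((b - x) + (- c) * s)) : R -> R.
have -> : (fun s => cone_fun (s, x)) = F.
  apply/funext => s; rewrite /cone_fun /F !fctE /sqpos /cone_l /cone_r /= !mulNr.
  by congr (_ * posp _ ^+ 2); ring.
apply: is_derive_eq; rewrite /GRing.scale /= /cone_dt !fctE /sqpos /cone_l /cone_r /= !mulNr.
rewrite (_ : b - x - c * t = b - c * t - x); last by ring.
by move: (posp _) (posp _) (ramp _ _) (dramp _ _) => p q r s; ring.
Qed.

Lemma is_derive_cone_dx z :
  is_derive z.2 1 (fun x => cone_fun (z.1, x)) (cone_dx z).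
Proof.
case: z => t x /=.
have dL : is_derive x 1 (fun s => sqpos ((- a - c * t) + 1 * s)) (1 * (2 * cone_l (t, x))).
  apply: is_derive_affine; rewrite /cone_l /= mul1r.
  by rewrite (_ : - a - c * t + x = x - a - c * t); [exact: is_derive_sqpos|ring].
have dR : is_derive x 1 (fun s => sqpos ((b - c * t) + (- 1) * s)) (- 1 * (2 * cone_r (t, x))).
  apply: is_derive_affine; rewrite /cone_r /= mulN1r; exact: is_derive_sqpos.
pose F := (ramp dl t \*: ((fun s => sqpos ((- a - c * t) + 1 * s)) *
          (fun s => sqpos ((b - c * t) + (- 1) * s)))) : R -> R.
have -> : (fun s => cone_fun (t, s)) = F.
  apply/funext => s; rewrite /cone_fun /F !fctE /GRing.scale /= /sqpos /cone_l /cone_r /= mulN1r mul1r.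
  rewrite (_ : - a - c * t + s = s - a - c * t); last by ring.
  by rewrite -mulrA.
apply: is_derive_eq; rewrite /GRing.scale /= /cone_dx /sqpos /cone_l /cone_r /= !mulN1r !mul1r.
rewrite (_ : - a - c * t + x = x - a - c * t); last by ring.
by move: (posp _) (posp _) (ramp _ _) => p q r; ring.
Qed.

Lemma partial_t_cone : partial_t cone_fun = cone_dt.
Proof.
apply/funext => z; rewrite /partial_t derive1E.
exact: (@derive_val _ _ _ _ _ _ _ (is_derive_cone_dt z)).
Qed.

Lemma partial_x_cone : partial_x cone_fun = cone_dx.
Proof.
apply/funext => z; rewrite /partial_x derive1E.
exact: (@derive_val _ _ _ _ _ _ _ (is_derive_cone_dx z)).
Qed.

(** When both factors are positive they add up to [b - a - 2 c t], so for [t >= 0] neither exceeds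
    [b - a]. *)
Lemma cone_lr z : 0 <= z.1 -> cone_l z * cone_r z = 0 \/
  [/\ cone_l z = z.2 - a - c * z.1, cone_r z = b - c * z.1 - z.2,
      0 < cone_l z <= b - a & 0 < cone_r z <= b - a].
Proof.
have c0 := c_gt0; move=> t0; have ct : 0 <= c * z.1 by rewrite mulr_ge0 // ltW.
rewrite /cone_l /cone_r.
have [h|h] := lerP (z.2 - a - c * z.1) 0; first by left; rewrite posp0 // mul0r.
have [h'|h'] := lerP (b - c * z.1 - z.2) 0; first by left; rewrite [X in _ * X]posp0 // mulr0.
right; rewrite !pospE; [|lra..].
by split => //; lra.
Qed.

Lemma cone_lr0 z : cone_l z * cone_r z = 0 -> cone_dt z = 0 /\ cone_dx z = 0.
Proof.
rewrite /cone_dt /cone_dx => /eqP; rewrite mulf_eq0 => /orP[] /eqP ->;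
 by split; rewrite ?expr0n /=; ring.
Qed.

(** The last time is that of the apex, where the two lateral sides meet. *)
Definition cone_box : set (R * R) := `[dl, (b - a) / (2 * c)] `*` `[a, b].

Lemma cone_support z : ~ cone_box z ->
  [/\ cone_fun z = 0, cone_dt z = 0 & cone_dx z = 0].
Proof.
have d0 := dl_gt0; have c0 := c_gt0.
case: z => t x nz; have [tdl|tdl] := lerP t dl.
  rewrite /cone_fun /cone_dt /cone_dx /= ramp0 // dramp0 //.
  by split; rewrite ?(mul0r, mulr0, subr0).
have t0 : 0 <= t by lra.
have ct : 0 <= c * t by rewrite mulr_ge0 // ltW.
have [h|[/= h1 h2 /andP[h3 h3'] /andP[h4 h4']]] := @cone_lr (t, x) t0.
  have [-> ->] := cone_lr0 h; split => //; rewrite /cone_fun -mulrA -exprMn h.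
  by rewrite expr0n mulr0.
exfalso; apply: nz; rewrite /cone_box /= !in_itv /=.
rewrite ler_pdivlMr; last lra.
by split; apply/andP; split; lra.
Qed.

Lemma cone_bound : exists K : R, forall z, `|cone_dt z| <= K /\ `|cone_dx z| <= K.
Proof.
pose D := b - a; pose K := 2 / dl * D ^+ 4 + (c + 1) * (4 * D ^+ 3).
(* For [b < a] the box is empty and [K] may be negative; the absolute value covers this case. *)
exists `|K| => z; have dl0 := dl_gt0.
have [zb|zb] := pselect (cone_box z); last first.
  by have [_ -> ->] := cone_support zb; rewrite normr0.
have t0 : 0 <= z.1.
  by move: zb => [] /=; rewrite in_itv /= => /andP[h _] _; lra.
have [h|[_ _ /andP[l0 l1] /andP[r0 r1]]] := cone_lr t0.
  by have [-> ->] := cone_lr0 h; rewrite normr0.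
rewrite /cone_dt /cone_dx -/D in l1 r1 *.
have /andP[x0 x1] := ramp_bounds z.1 dl_gt0.
have /andP[d0 d1] := dramp_bounds z.1 dl_gt0.
move: l0 l1 r0 r1 x0 x1 d0 d1.
move: (cone_l z) (cone_r z) (ramp dl z.1) (dramp dl z.1) => l r x d l0 l1 r0 r1 x0 x1 d0 d1.
have D0 : 0 < D by lra.
have l2 : 0 <= l ^+ 2 <= D ^+ 2 by rewrite sqr_ge0 lerXn2r ?nnegrE; lra.
have r2 : 0 <= r ^+ 2 <= D ^+ 2 by rewrite sqr_ge0 lerXn2r ?nnegrE; lra.
have pm (u v U V : R) : 0 <= u <= U -> 0 <= v <= V -> 0 <= u * v <= U * V.
  by move=> /andP[u0 u1] /andP[v0 v1]; rewrite mulr_ge0 // ler_pM.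
have e1 : 0 <= l ^+ 2 * r ^+ 2 <= D ^+ 4.
  by rewrite (_ : D ^+ 4 = D ^+ 2 * D ^+ 2); [exact: pm|rewrite -exprD].
have e2 : 0 <= l * r ^+ 2 <= D ^+ 3.
  by rewrite (exprS D 2); apply: pm => //; rewrite l1 ltW.
have e3 : 0 <= l ^+ 2 * r <= D ^+ 3.
  by rewrite (exprSr D 2); apply: pm => //; rewrite r1 ltW.
have e4 : 0 <= d * (l ^+ 2 * r ^+ 2) <= 2 / dl * D ^+ 4 by apply: pm => //; rewrite d0.
have e5 : 0 <= x * (l * r ^+ 2) <= 1 * D ^+ 3 by apply: pm => //; rewrite x0.
have e6 : 0 <= x * (l ^+ 2 * r) <= 1 * D ^+ 3 by apply: pm => //; rewrite x0.
have e7 : 0 <= c * (x * (l * r ^+ 2)) <= c * (1 * D ^+ 3).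
  by apply: pm => //; rewrite ltW /=.
have e8 : 0 <= c * (x * (l ^+ 2 * r)) <= c * (1 * D ^+ 3).
  by apply: pm => //; rewrite ltW /=.
rewrite !mul1r in e5 e6 e7 e8.
have E1 : d * (l ^+ 2 * r ^+ 2) - c * x * (2 * l * r ^+ 2 + 2 * l ^+ 2 * r) =
  d * (l ^+ 2 * r ^+ 2) - 2 * (c * (x * (l * r ^+ 2))) - 2 * (c * (x * (l ^+ 2 * r))) by ring.
have E2 : x * (2 * l * r ^+ 2 - 2 * l ^+ 2 * r) = 
  2 * (x * (l * r ^+ 2)) - 2 * (x * (l ^+ 2 * r)) by ring.
have EK : K = 2 / dl * D ^+ 4 + 4 * (c * D ^+ 3) + 4 * D ^+ 3 by rewrite /K; ring.
rewrite E1 E2; clear E1 E2.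
have -> : `|K| = K.
  rewrite ger0_norm // EK.
  by move: e4 e5 e7 => /andP[? ?] /andP[? ?] /andP[? ?]; lra.
rewrite EK; clear EK.
move: e2 e3 e4 e5 e6 e7 e8.
move: (x * (l * r ^+ 2)) (x * (l ^+ 2 * r)) (d * _) (l * r ^+ 2) (l ^+ 2 * r) => A1 A2 A3 A4 A5.
move: (c * A1) (c * A2) (c * D ^+ 3) (2 / dl * D ^+ 4) (D ^+ 3) => B1 B2 B3 B4 B5.
move=> /andP[? ?] /andP[? ?] /andP[? ?] /andP[? ?] /andP[? ?] /andP[? ?] /andP[? ?].
by split; rewrite ler_norml; apply/andP; split; lra.
Qed.

Lemma cone_fun_ge0 z : 0 <= cone_fun z.
Proof.
have /andP[? _] := ramp_bounds z.1 dl_gt0.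
by apply: mulr_ge0; [apply: mulr_ge0 => //|]; exact: sqr_ge0.
Qed.

Lemma continuous_cone_l : continuous cone_l.
Proof.
move=> z; apply: (@continuous_comp _ _ _ (fun z : R * R => z.2 - a - c * z.1)); last first.
  exact: continuous_posp.
apply: cvgB; first by apply: cvgB; [exact: cvg_snd|exact: cvg_cst].
by apply: cvgM; [exact: cvg_cst|exact: cvg_fst].
Qed.

Lemma continuous_cone_r : continuous cone_r.
Proof.
move=> z; apply: (@continuous_comp _ _ _ (fun z : R * R => b - c * z.1 - z.2)); last first.
  exact: continuous_posp.
apply: cvgB; last exact: cvg_snd.
by apply: cvgB; [exact: cvg_cst|apply: cvgM; [exact: cvg_cst|exact: cvg_fst]].
Qed.

Lemma continuous_ramp : continuous (ramp dl).
Proof.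
move=> t; apply: differentiable_continuous; apply/derivable1_diffP.
exact: (@ex_derive _ _ _ _ _ _ _ (is_derive_ramp t dl_gt0)).
Qed.

Lemma continuous_dramp : continuous (dramp dl).
Proof.
have cp (k : R) : continuous (fun t : R => posp (t - k)).
  move=> t; apply: (@continuous_comp _ _ _ (fun t : R => t - k)); last exact: continuous_posp.
  by apply: cvgB; [exact: cvg_id|exact: cvg_cst].
move=> t; rewrite /dramp; apply: cvgM; last exact: cvg_cst.
apply: cvgD; [apply: cvgB|]; apply: cvgM; try exact: cvg_cst; exact: cp.
Qed.

Lemma continuous_cone_dt : continuous cone_dt.
Proof.
move=> z.
have cl : {for z, continuous cone_l} by exact: continuous_cone_l.
have cr : {for z, continuous cone_r} by exact: continuous_cone_r.
have c1 : {for z, continuous (fun z : R * R => ramp dl z.1)}.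
  apply: continuous_comp; [exact: cvg_fst|exact: continuous_ramp].
have c2 : {for z, continuous (fun z : R * R => dramp dl z.1)}.
  apply: continuous_comp; [exact: cvg_fst|exact: continuous_dramp].
have cl2 : {for z, continuous (fun z : R * R => cone_l z ^+ 2)} by exact: cvgM.
have cr2 : {for z, continuous (fun z : R * R => cone_r z ^+ 2)} by exact: cvgM.
have cc (k : R) (F : R * R -> R) : {for z, continuous F} ->
  {for z, continuous (fun z : R * R => k * F z)}.
  by move=> cF; apply: cvgM => //; exact: cvg_cst.
apply: cvgB; first by apply: cvgM => //; exact: cvgM.
apply: cvgM; first exact: (cc c).
apply: cvgD; apply: cvgM => //; exact: (cc 2).
Qed.

Lemma continuous_cone_dx : continuous cone_dx.
Proof.
move=> z.
have cl : {for z, continuous cone_l} by exact: continuous_cone_l.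
have cr : {for z, continuous cone_r} by exact: continuous_cone_r.
have c1 : {for z, continuous (fun z : R * R => ramp dl z.1)}.
  apply: continuous_comp; [exact: cvg_fst|exact: continuous_ramp].
have cl2 : {for z, continuous (fun z : R * R => cone_l z ^+ 2)} by exact: cvgM.
have cr2 : {for z, continuous (fun z : R * R => cone_r z ^+ 2)} by exact: cvgM.
have cc (k : R) (F : R * R -> R) : {for z, continuous F} ->
  {for z, continuous (fun z : R * R => k * F z)}.
  by move=> cF; apply: cvgM => //; exact: cvg_cst.
apply: cvgM => //.
apply: cvgB; apply: cvgM => //; exact: (cc 2).
Qed.

Lemma test_function_cone : test_function cone_fun.
Proof.
have d0 := dl_gt0.
have clb : closed cone_box.
  apply: compact_closed; first exact: norm_hausdorff.
  by apply: compact_setX; exact: segment_compact.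
have sub : closure [set z | cone_fun z != 0] `<=` cone_box.
  rewrite [X in _ `<=` X](closure_id _).1 //; apply: closure_subset => z /=.
  by apply: contraNP => /cone_support[-> _ _].
split.
- split.
  + by move=> z; exact: (@ex_derive _ _ _ _ _ _ _ (is_derive_cone_dt z)).
  + by move=> z; exact: (@ex_derive _ _ _ _ _ _ _ (is_derive_cone_dx z)).
  + rewrite partial_t_cone; exact: continuous_cone_dt.
  + rewrite partial_x_cone; exact: continuous_cone_dx.
- apply: subclosed_compact sub; first exact: closed_closure.
  by apply: compact_setX; exact: segment_compact.
- move=> z /sub [/=]; rewrite in_itv /= => /andP[h _] _.
  by rewrite /half_plane /=; lra.
Qed.

Let mfst : measurable_fun setT (@fst R R). Proof. exact: measurable_fst. Qed.
Let msnd : measurable_fun setT (@snd R R). Proof. exact: measurable_snd. Qed.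

Lemma measurable_cone_l : measurable_fun setT cone_l.
Proof.
apply: measurable_maxr => //; apply: measurable_funB.
  by apply: measurable_funB.
by apply: measurable_funM.
Qed.

Lemma measurable_cone_r : measurable_fun setT cone_r.
Proof.
apply: measurable_maxr => //; apply: measurable_funB => //.
by apply: measurable_funB => //; apply: measurable_funM.
Qed.

Lemma measurable_ramp_fst : measurable_fun setT (fun z : R * R => ramp dl z.1).
Proof.
apply: (measurableT_comp (f := ramp dl)) => //.
by apply: continuous_measurable_fun; exact: continuous_ramp.
Qed.

Lemma measurable_dramp_fst : measurable_fun setT (fun z : R * R => dramp dl z.1).
Proof.
apply: (measurableT_comp (f := dramp dl)) => //.
by apply: continuous_measurable_fun; exact: continuous_dramp.
Qed.

Lemma measurable_cone_dt : measurable_fun setT cone_dt.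
Proof.
have ml := measurable_cone_l; have mr := measurable_cone_r.
have m1 := measurable_ramp_fst; have m2 := measurable_dramp_fst.
apply: measurable_funB.
  by apply: measurable_funM => //; apply: measurable_funM; exact: measurable_funX.
apply: measurable_funM; first exact: measurable_funM.
by apply: measurable_funD; apply: measurable_funM => //;
  try apply: measurable_funM => //; exact: measurable_funX.
Qed.

Lemma measurable_cone_dx : measurable_fun setT cone_dx.
Proof.
have ml := measurable_cone_l; have mr := measurable_cone_r.
have m1 := measurable_ramp_fst.
apply: measurable_funM => //.
by apply: measurable_funB; apply: measurable_funM => //;
  try apply: measurable_funM => //; exact: measurable_funX.
Qed.

End cone_test_function.

(** * Integration over the plane *)

Section plane_integration.
Context {R : realType}.
Local Notation mu := (@lebesgue_measure R).
Local Notation mu2 := (mu \x mu)%E.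
Implicit Types (F : R * R -> R) (z : R * R).

Lemma integrable_bounded_box F (K t0 t1 x0 x1 : R) :
  measurable_fun setT F -> (forall z, `|F z| <= K) ->
  (forall z, ~ (`[t0, t1] `*` `[x0, x1]) z -> F z = 0) ->
  mu2.-integrable setT (EFin \o F).
Proof.
move=> mF FK F0; pose B : set (R * R) := `[t0, t1] `*` `[x0, x1].
have mB : measurable B by apply: measurableX; exact: measurable_itv.
have -> : EFin \o F = (EFin \o F) \_ B.
  apply/funext => z; rewrite patchE; case: ifPn => // /negP zB /=.
  by rewrite F0 // => zB'; apply: zB; rewrite inE.
have fB : (mu2 B < +oo)%E.
  have -> : mu2 B = (mu `[t0, t1] * mu `[x0, x1])%E.
    by apply: product_measure1E; exact: measurable_itv.
  rewrite !lebesgue_measure_itv /=.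
  by case: ifPn => _; case: ifPn => _; rewrite ?mule0 ?mul0e ?ltry // -!EFinB -EFinM ltry.
have [H _] := @integrable_mkcond _ _ _ mu2 B (EFin \o F) mB.
apply: H; apply: (@measurable_bounded_integrable _ _ _ mu2 F B mB fB).
- exact: measurable_funTS.
- by exists K; split; rewrite ?num_real // => k Kk z _; apply: (le_trans (FK z)); exact: ltW.
Qed.

Lemma prod_measure_eq0 (N : set (R * R)) : measurable N ->
  (forall t, mu (xsection N t) = 0%E) -> mu2 N = 0%E.
Proof.
move=> mN N0; rewrite /product_measure1 /=.
under eq_integral do rewrite /= N0.
by rewrite integral0.
Qed.

Lemma integral_derivative_compact (G g : R -> R) (lo hi : R) : lo < hi ->
  (forall x : R, is_derive x 1 G (g x)) -> continuous g ->
  (forall x : R, ~ (`[lo, hi]%classic x) -> g x = 0) -> G lo = 0 -> G hi = 0 ->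
  (\int[mu]_x (g x)%:E = 0)%E.
Proof.
move=> lohi dG cg g0 Glo Ghi.
have cG : continuous G.
  move=> x; apply: differentiable_continuous; apply/derivable1_diffP.
  exact: (@ex_derive _ _ _ _ _ _ _ (dG x)).
transitivity (\int[mu]_(x in `[lo, hi]) (g x)%:E)%E.
  rewrite [RHS]integral_mkcond; apply: eq_integral => x _; rewrite patchE.
  case: ifPn => // /negP xB; rewrite g0 // => xB'; apply: xB.
  by rewrite inE.
rewrite (@continuous_FTC2 R g G lo hi) ?Glo ?Ghi ?subee //.
- by apply: continuous_subspaceT.
- split.
  + by move=> x _; exact: (@ex_derive _ _ _ _ _ _ _ (dG x)).
  + by apply: cvg_at_right_filter; exact: cG.
  + by apply: cvg_at_left_filter; exact: cG.
- move=> x _; rewrite derive1E; exact: (@derive_val _ _ _ _ _ _ _ (dG x)).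
Qed.

Lemma integrable_cone_dt (a b c dl : R) : 0 < c -> 0 < dl ->
  mu2.-integrable setT (EFin \o cone_dt a b c dl).
Proof.
move=> c0 d0; have [K HK] := cone_bound a b c0 d0.
apply: (@integrable_bounded_box _ K dl ((b - a) / (2 * c)) a b).
- exact: measurable_cone_dt.
- by move=> z; have [] := HK z.
- by move=> z zB; have [] := @cone_support _ a b c dl c0 d0 z zB.
Qed.

Lemma integrable_cone_dx (a b c dl : R) : 0 < c -> 0 < dl ->
  mu2.-integrable setT (EFin \o cone_dx a b c dl).
Proof.
move=> c0 d0; have [K HK] := cone_bound a b c0 d0.
apply: (@integrable_bounded_box _ K dl ((b - a) / (2 * c)) a b).
- exact: measurable_cone_dx.
- by move=> z; have [] := HK z.
- by move=> z zB; have [] := @cone_support _ a b c dl c0 d0 z zB.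
Qed.

Lemma integrable_cone_comb (a b c dl K1 K2 : R) (P Q : R * R -> R) :
  0 < c -> 0 < dl -> measurable_fun setT P -> measurable_fun setT Q ->
  (forall z, `|P z| <= K1) -> (forall z, `|Q z| <= K2) ->
  mu2.-integrable setT
    (EFin \o (fun z => P z * cone_dt a b c dl z + Q z * cone_dx a b c dl z)).
Proof.
move=> c0 d0 mP mQ P1 Q2; have [K HK] := cone_bound a b c0 d0.
apply: (@integrable_bounded_box _ (K1 * K + K2 * K) dl ((b - a) / (2 * c)) a b).
- apply: measurable_funD; apply: measurable_funM => //.
    exact: measurable_cone_dt.
  exact: measurable_cone_dx.
- move=> z; have [h1 h2] := HK z; apply: (le_trans (ler_normD _ _)).
  by apply: lerD; rewrite normrM; exact: ler_pM.
- move=> z zB; have [_ -> ->] := @cone_support _ a b c dl c0 d0 z zB.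
  by rewrite !mulr0 addr0.
Qed.

(** The entropy of the maximum principle and its flux carry additive constants; this and
    [integral_cone_dx] show that they contribute nothing. *)
Lemma integral_cone_dt (a b c dl : R) : 0 < c -> 0 < dl ->
  (\int[mu2]_z (cone_dt a b c dl z)%:E = 0)%E.
Proof.
move=> c0 d0; rewrite -(integral21_prod_meas1 (integrable_cone_dt a b c0 d0)).
rewrite /fubini_G; apply: integral0_eq => x _.
(* The ends [dl - 1] and [hi] lie strictly outside the time range of the box, so the primitive
   [cone_fun] vanishes at both. *)
set hi := dl + `|(b - a) / (2 * c)| + 1.
have sup t : ~ (`[dl - 1, hi]%classic t) \/ t = dl - 1 \/ t = hi -> 
    cone_fun a b c dl (t, x) = 0 /\ cone_dt a b c dl (t, x) = 0.
  move=> ht; have [] // := @cone_support _ a b c dl c0 d0 (t, x).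
  move=> [/=]; rewrite !in_itv /= => /andP[h1 h2] _.
  have h3 := ler_norm ((b - a) / (2 * c)); move: ht; rewrite /hi /= in_itv /=.
  case=> [|[]]; [|lra..].
  by apply; apply/andP; split; lra.
apply: (@integral_derivative_compact (fun t => cone_fun a b c dl (t, x))
  (fun t => cone_dt a b c dl (t, x)) (dl - 1) hi).
- by rewrite /hi; have := normr_ge0 ((b - a) / (2 * c)); lra.
- by move=> t; exact: (is_derive_cone_dt a b c d0 (t, x)).
- move=> t; apply: (@continuous_comp _ _ _ (fun t : R => (t, x))); last exact: continuous_cone_dt.
  exact: (cvg_pair cvg_id (cvg_cst x)).
- by move=> t ht; have [] := sup t (or_introl ht).
- by have [] := sup (dl - 1) (or_intror (or_introl erefl)).
- by have [] := sup hi (or_intror (or_intror erefl)).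
Qed.

Lemma integral_cone_dx (a b c dl : R) : 0 < c -> 0 < dl ->
  (\int[mu2]_z (cone_dx a b c dl z)%:E = 0)%E.
Proof.
move=> c0 d0; rewrite -(integral12_prod_meas1 (integrable_cone_dx a b c0 d0)).
rewrite /fubini_F; apply: integral0_eq => t _.
set lo := a - 1; set hi := a + `|b - a| + 1.
have sup x : ~ (`[lo, hi]%classic x) \/ x = lo \/ x = hi -> 
    cone_fun a b c dl (t, x) = 0 /\ cone_dx a b c dl (t, x) = 0.
  move=> ht; have [] // := @cone_support _ a b c dl c0 d0 (t, x).
  move=> [/=]; rewrite !in_itv /= => _ /andP[h1 h2].
  have h3 := ler_norm (b - a); move: ht; rewrite /hi /lo /= in_itv /=.
  case=> [|[]]; [|lra..].
  by apply; apply/andP; split; lra.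
apply: (@integral_derivative_compact (fun x => cone_fun a b c dl (t, x))
  (fun x => cone_dx a b c dl (t, x)) lo hi).
- by rewrite /hi /lo; have := normr_ge0 (b - a); lra.
- by move=> x; exact: (is_derive_cone_dx a b c dl (t, x)).
- move=> x; apply: (@continuous_comp _ _ _ (fun x : R => (t, x))); last exact: continuous_cone_dx.
  exact: (cvg_pair (cvg_cst t) cvg_id).
- by move=> x hx; have [] := sup x (or_introl hx).
- by have [] := sup lo (or_intror (or_introl erefl)).
- by have [] := sup hi (or_intror (or_intror erefl)).
Qed.

End plane_integration.

(** * The cone estimate *)

Section cone_estimate.
Context {R : realType}.
Local Notation mu := (@lebesgue_measure R).
Local Notation mu2 := (mu \x mu)%E.
Variables (a b c K : R) (W Q : R * R -> R).
Hypotheses (c_gt0 : 0 < c) (mW : measurable_fun setT W)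
  (mQ : measurable_fun setT Q) (W_ge0 : forall z, 0 <= W z)
  (W_le : forall z, W z <= K) (QW : forall z, `|Q z| <= c * W z).
Hypothesis entropy_ge0 : forall dl : R, 0 < dl ->
  0 <= (\int[mu2]_z (W z * cone_dt a b c dl z + Q z * cone_dx a b c dl z))%R.
Hypothesis W_to0 : forall kappa : R, 0 < kappa -> exists2 t0 : R, 0 < t0 &
  forall t, 0 < t -> t <= t0 ->
    (\int[mu]_(x in `]a, b[) (W (t, x))%:E <= kappa%:E)%E.

Local Notation l := (cone_l a c).
Local Notation r := (cone_r b c).

(** The term due to the time cutoff. It lives on the strip [dl <= t <= 2 dl], where [W_to0] makes
    [W] small. *)
Let J1 dl z := dramp dl z.1 * (l z ^+ 2 * r z ^+ 2) * W z.

(* With [psi := l ^+ 2 * r ^+ 2], this is [- psi_t - c * `|psi_x|]; its positivity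
   inside the cone is what forces [W] to vanish there. *)
Definition cone_gap z : R := c * ((2 * l z * r z ^+ 2 + 2 * l z ^+ 2 * r z) -
  `|2 * l z * r z ^+ 2 - 2 * l z ^+ 2 * r z|).

Lemma cone_gap_ge0 z : 0 <= cone_gap z.
Proof.
rewrite /cone_gap mulr_ge0 ?(ltW c_gt0) // subr_ge0.
have l0 : 0 <= l z by exact: posp_ge0.
have r0 : 0 <= r z by exact: posp_ge0.
have A0 : 0 <= 2 * l z * r z ^+ 2 by rewrite mulr_ge0 ?sqr_ge0 // mulr_ge0.
have B0 : 0 <= 2 * l z ^+ 2 * r z by rewrite mulr_ge0 // mulr_ge0 ?sqr_ge0.
by rewrite ler_norml; apply/andP; split; lra.
Qed.

Lemma cone_gap_gt0 (t x : R) : a + c * t < x -> x < b - c * t -> 0 < cone_gap (t, x).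
Proof.
move=> h1 h2; rewrite /cone_gap mulr_gt0 // subr_gt0.
have l0 : 0 < l (t, x) by rewrite /cone_l pospE /=; lra.
have r0 : 0 < r (t, x) by rewrite /cone_r pospE /=; lra.
have A0 : 0 < 2 * l (t, x) * r (t, x) ^+ 2 by rewrite mulr_gt0 ?exprn_gt0 // mulr_gt0.
have B0 : 0 < 2 * l (t, x) ^+ 2 * r (t, x) by rewrite mulr_gt0 // mulr_gt0 ?exprn_gt0.
by rewrite ltr_norml; apply/andP; split; lra.
Qed.

Let J1_ge0 dl z : 0 < dl -> 0 <= J1 dl z.
Proof.
move=> d0; have /andP[h _] := dramp_bounds z.1 d0.
by rewrite /J1; apply: mulr_ge0 => //; apply: mulr_ge0 => //; apply: mulr_ge0; exact: sqr_ge0.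
Qed.

Let J1_le dl t x : 0 < dl ->
  J1 dl (t, x) <= 2 / dl * (b - a) ^+ 4 * \1_(`[dl, 2 * dl]) t * \1_(`]a, b[) x * W (t, x).
Proof.
move=> d0; rewrite /J1 ler_wpM2r //= !indicE.
have D0 : 0 <= 2 / dl * (b - a) ^+ 4.
  by rewrite mulr_ge0 ?divr_ge0 ?(ltW d0) // (_ : _ ^+ 4 = ((b - a) ^+ 2) ^+ 2) ?sqr_ge0 // -exprM.
have RH : 0 <= 2 / dl * (b - a) ^+ 4 * (t \in `[dl, 2 * dl]%classic)%:R *
    (x \in `]a, b[%classic)%:R.
  by apply: mulr_ge0 => //; exact: mulr_ge0.
have [h1|h1] := lerP t dl; first by rewrite dramp0 // mul0r.
have [h2|h2] := lerP (2 * dl) t; first by rewrite dramp_out // mul0r.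
have t0 : 0 <= t by lra.
have c0 := c_gt0.
have [h|[/= e1 e2 /andP[l0 l1] /andP[r0 r1]]] := @cone_lr _ a b c c_gt0 (t, x) t0.
  by rewrite -exprMn h expr0n mulr0.
have ct : 0 <= c * t by rewrite mulr_ge0 // ltW.
rewrite !mem_set /= ?in_itv /=; [|by apply/andP; split; lra..].
rewrite !mulr1; have /andP[d1 d2] := dramp_bounds t d0.
apply: ler_pM => //; first by rewrite mulr_ge0 ?sqr_ge0.
rewrite (_ : (b - a) ^+ 4 = (b - a) ^+ 2 * (b - a) ^+ 2); last by rewrite -exprD.
by apply: ler_pM; rewrite ?sqr_ge0 // lerXn2r // nnegrE; lra.
Qed.

Let mJ1 dl : 0 < dl -> measurable_fun setT (J1 dl).
Proof.
move=> d0; apply: measurable_funM => //; apply: measurable_funM.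
  exact: measurable_dramp_fst.
by apply: measurable_funM; apply: measurable_funX;
  [exact: measurable_cone_l|exact: measurable_cone_r].
Qed.

Lemma measurable_cone_gap : measurable_fun setT cone_gap.
Proof.
have ml := measurable_cone_l a c; have mr := measurable_cone_r b c.
have m1 : measurable_fun setT (fun z : R * R => 2 * l z * r z ^+ 2).
  by apply: measurable_funM; [exact: measurable_funM|exact: measurable_funX].
have m2 : measurable_fun setT (fun z : R * R => 2 * l z ^+ 2 * r z).
  by apply: measurable_funM => //; apply: measurable_funM => //; exact: measurable_funX.
apply: measurable_funM => //; apply: measurable_funB; first exact: measurable_funD.
by apply: measurableT_comp => //; exact: measurable_funB.
Qed.

Let J1_out dl z : 0 < dl -> ~ (`[dl, 2 * dl] `*` `[a, b]) z -> J1 dl z = 0.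
Proof.
case: z => t x d0 h; apply/eqP; rewrite eq_le J1_ge0 // andbT.
apply: (le_trans (J1_le t x d0)); rewrite le_eqVlt; apply/orP; left; apply/eqP.
rewrite !indicE; case: (boolP (t \in _)) => ht; last by rewrite !(mulr0, mul0r).
case: (boolP (x \in _)) => hx; last by rewrite !(mulr0, mul0r).
exfalso; apply: h; split => /=; first by move: ht; rewrite inE.
by move: hx; rewrite inE /=; exact: subset_itv_oo_cc.
Qed.

Let iJ1 dl : 0 < dl -> mu2.-integrable setT (EFin \o J1 dl).
Proof.
move=> d0.
apply: (@integrable_bounded_box _ _ (2 / dl * (b - a) ^+ 4 * K) dl (2 * dl) a b).
- exact: mJ1.
- move=> [t x]; rewrite ger0_norm ?J1_ge0 //; apply: (le_trans (J1_le t x d0)).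
  have D0 : 0 <= 2 / dl * (b - a) ^+ 4.
    by rewrite mulr_ge0 ?divr_ge0 ?(ltW d0) // (_ : _ ^+ 4 = ((b - a) ^+ 2) ^+ 2) ?sqr_ge0 // -exprM.
  have K0 : 0 <= K by apply: le_trans (W_le (t, x)).
  have CK : 0 <= 2 / dl * (b - a) ^+ 4 * K by exact: mulr_ge0.
  rewrite !indicE; case: (t \in _); case: (x \in _); rewrite ?(mulr0, mul0r, mulr1) //.
  exact: ler_wpM2l.
- by move=> z hz; exact: J1_out.
Qed.

(** As [|Q| <= c * W], the derivatives of [psi] contribute at most [- W * cone_gap], so the entropy
    inequality bounds the left side by the integral of [J1]. There the height [2 / dl] of [dramp] is
    balanced by the width [dl] of the strip, and the bound does not depend on [dl]. *)
Lemma integral_cone_gap_le (dl kappa : R) : 0 < dl -> 0 < kappa ->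
  (forall t, dl <= t -> t <= 2 * dl ->
    (\int[mu]_(x in `]a, b[) (W (t, x))%:E <= kappa%:E)%E) ->
  (\int[mu2]_z (ramp dl z.1 * (W z * cone_gap z))%:E <=
     (2 * (b - a) ^+ 4 * kappa)%:E)%E.
Proof.
move=> d0 k0 hk.
pose I z := W z * cone_dt a b c dl z + Q z * cone_dx a b c dl z.
have mI : measurable_fun setT I.
  apply: measurable_funD; apply: measurable_funM => //.
    exact: measurable_cone_dt.
  exact: measurable_cone_dx.
have iI : mu2.-integrable setT (EFin \o I).
  apply: (@integrable_cone_comb _ a b c dl K (c * K)) => // z.
    by rewrite ger0_norm.
  by apply: (le_trans (QW z)); rewrite ler_wpM2l // ltW.
have g0 := cone_gap_ge0.
have rb (z : R * R) := ramp_bounds z.1 d0.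
have le1 z : ramp dl z.1 * (W z * cone_gap z) <= J1 dl z - I z.
  rewrite /J1 /I /cone_dt /cone_dx /cone_gap.
  have /andP[x0 _] := rb z; have := QW z; have := W_ge0 z.
  move: (dramp dl z.1) (ramp dl z.1) x0 (W z) (Q z) => d x x0 w q w0 qw.
  set A := 2 * l z * r z ^+ 2; set B := 2 * l z ^+ 2 * r z.
  rewrite -subr_ge0.
  have -> : d * (l z ^+ 2 * r z ^+ 2) * w - (w * (d * (l z ^+ 2 * r z ^+ 2) -
      c * x * (A + B)) + q * (x * (A - B))) - x * (w * (c * (A + B - `|A - B|))) =
      x * (c * w * `|A - B| - q * (A - B)) by ring.
  rewrite mulr_ge0 // subr_ge0.
  apply: (le_trans (ler_norm _)); rewrite normrM; exact: ler_wpM2r.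
apply: (@le_trans _ _ (\int[mu2]_z (J1 dl z - I z)%:E)%E).
  apply: ge0_le_integral => //.
  - move=> z _; rewrite lee_fin; apply: mulr_ge0; last exact: mulr_ge0.
    by have /andP[] := rb z.
  - apply/measurable_EFinP; apply: measurable_funM; first exact: measurable_ramp_fst.
    by apply: measurable_funM => //; exact: measurable_cone_gap.
  - by apply/measurable_EFinP; apply: measurable_funB => //; exact: mJ1.
  - by move=> z _; rewrite lee_fin.
under eq_integral do rewrite EFinB.
rewrite integralB //; [|exact: iJ1].
have I0 : (0 <= \int[mu2]_z (I z)%:E)%E.
  have := entropy_ge0 d0; rewrite /Rintegral -lee_fin fineK //.
  exact: integrable_fin_num.
apply: (@le_trans _ _ (\int[mu2]_z (J1 dl z)%:E)%E).
  by rewrite leeBlDr ?leeDl //; exact: integrable_fin_num.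
have mJ := mJ1 d0.
rewrite (@fubini_tonelli1 _ _ _ _ _ mu mu (EFin \o J1 dl)); last 2 first.
  exact/measurable_EFinP.
  by move=> z; rewrite lee_fin J1_ge0.
pose C := 2 / dl * (b - a) ^+ 4.
have C0 : 0 <= C.
  by rewrite mulr_ge0 ?divr_ge0 ?(ltW d0) // (_ : _ ^+ 4 = ((b - a) ^+ 2) ^+ 2) ?sqr_ge0 // -exprM.
have mWt t : measurable_fun setT (fun x => W (t, x)).
  by apply: measurableT_comp => //; exact: pair1_measurable.
have mJt t : measurable_fun setT (fun x => J1 dl (t, x)).
  by apply: measurableT_comp => //; exact: pair1_measurable.
(* After Tonelli, each time slice of the strip contributes at most [C * kappa], and the other slices
   nothing. *)
apply: (@le_trans _ _ (\int[mu]_t ((C * kappa)%:E * (\1_(`[dl, 2 * dl]) t)%:E))%E).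
  apply: ge0_le_integral => //.
  - by move=> t _; apply: integral_ge0 => x _; rewrite lee_fin J1_ge0.
  - apply: (@measurable_fun_fubini_tonelli_F _ _ _ _ _ mu (EFin \o J1 dl)).
      exact/measurable_EFinP.
    by move=> z; rewrite lee_fin J1_ge0.
  - by apply/measurable_EFinP; apply: measurable_funM => //; apply: measurable_indic; exact: measurable_itv.
  move=> t _; rewrite /fubini_F /= indicE.
  case: (boolP (t \in _)) => ht; last first.
    rewrite mule0 integral0_eq // => x _; rewrite J1_out // => -[/= h _].
    by move: ht; rewrite notin_setE; apply.
  rewrite mule1.
  have /andP[t1 t2] : dl <= t <= 2 * dl by move: ht; rewrite inE /= in_itv.
  apply: (@le_trans _ _ (\int[mu]_(x in `]a, b[) (C%:E * (W (t, x))%:E))%E).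
    rewrite [leRHS]integral_mkcond; apply: ge0_le_integral => //.
    + by move=> x _; rewrite lee_fin J1_ge0.
    + by apply/measurable_EFinP; exact: mJt.
    + apply/(measurable_restrictT _ _).1; first exact: measurable_itv.
      have mCW : measurable_fun setT (fun x => (C * W (t, x))%:E).
        by apply/measurable_EFinP; exact: measurable_funM.
      exact: (measurable_funTS mCW).
    move=> x _; rewrite patchE.
    have := J1_le t x d0; rewrite -/C !indicE ht mulr1.
    case: (x \in _); rewrite ?(mulr1, mulr0, mul0r) /=; last by rewrite lee_fin.
    by rewrite -EFinM lee_fin.
  rewrite ge0_integralZl //; first last.
  - by move=> x _; rewrite lee_fin.
  - apply: measurable_funTS; have mWte := mWt t; exact/measurable_EFinP.
  by rewrite (EFinM C kappa); apply: lee_wpmul2l; [rewrite lee_fin|exact: hk].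
rewrite ge0_integralZl //; first last.
- by rewrite lee_fin mulr_ge0 // ltW.
- have mi : measurable_fun setT (\1_(`[dl, 2 * dl]%classic : set R) : R -> R).
    by apply: measurable_indic; exact: measurable_itv.
  by apply/measurable_EFinP; exact: mi.
rewrite integral_indic ?setIT //.
pose I2 : set R := `[dl, 2 * dl]%classic.
have mE : mu I2 = dl%:E.
  etransitivity; first exact: (lebesgue_measure_itv `[dl, 2 * dl]%R).
  rewrite /= lte_fin ifT -?EFinB; last lra.
  by congr EFin; ring.
suff H : ((C * kappa)%:E * mu I2 <= (2 * (b - a) ^+ 4 * kappa)%:E)%E by exact: H.
rewrite mE -EFinM lee_fin /C le_eqVlt; apply/orP; left; apply/eqP; field; lra.
Qed.

(** For small [dl] the ramp equals 1 past [tau], so the integral of [W * cone_gap] over [t > tau] is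
    at most a constant times any [kappa > 0], hence zero; inside the cone [cone_gap] is positive. *)
Lemma cone_vanish (tau : R) : 0 < tau -> \forall t \ae mu, tau < t ->
  \forall x \ae mu, a + c * t < x -> x < b - c * t -> W (t, x) = 0.
Proof.
move=> tau0; pose P z := \1_(`]tau, +oo[) z.1 * (W z * cone_gap z).
have P0 z : 0 <= P z.
  by rewrite /P indicE; apply: mulr_ge0 => //; apply: mulr_ge0 => //; exact: cone_gap_ge0.
have mP : measurable_fun setT P.
  apply: measurable_funM; last by apply: measurable_funM => //; exact: measurable_cone_gap.
  have mi : measurable_fun setT (\1_(`]tau, +oo[%classic : set R) : R -> R).
    by apply: measurable_indic; exact: measurable_itv.
  have mf : measurable_fun setT (@fst R R) by exact: measurable_fst.
  exact: (measurableT_comp mi mf).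
have meP : measurable_fun setT (EFin \o P) by exact/measurable_EFinP.
have P0e z : (0 <= (EFin \o P) z)%E by rewrite lee_fin.
have iP : (\int[mu2]_z (P z)%:E = 0)%E.
  apply/eqP; rewrite eq_le [X in _ && X]integral_ge0 ?andbT; last first.
    by move=> z _; exact: P0e.
  (* The summand 1 keeps [C] positive when [a = b]. *)
  pose C := 2 * (b - a) ^+ 4 + 1.
  have C0 : 0 < C.
    rewrite ltr_pwDr // mulr_ge0 // (_ : _ ^+ 4 = ((b - a) ^+ 2) ^+ 2) ?sqr_ge0 //.
    by rewrite -exprM.
  apply/lee_addgt0Pr => e e0; rewrite add0e.
  have e1 : 0 < e / C by rewrite divr_gt0.
  have [t0 t00 ht0] := W_to0 e1.
  (* [2 * dl <= tau] completes the ramp before [tau]; [2 * dl <= t0] keeps the strip where [W_to0]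
     applies. *)
  pose dl := Num.min (tau / 2) (t0 / 2).
  have d0 : 0 < dl by rewrite lt_min !divr_gt0.
  have dt' : dl <= t0 / 2 by rewrite ge_min lexx orbT.
  have dtau' : dl <= tau / 2 by rewrite ge_min lexx.
  have dt : 2 * dl <= t0 by lra.
  have dtau : 2 * dl <= tau by lra.
  have := @integral_cone_gap_le dl (e / C) d0 e1.
  have h t : dl <= t -> t <= 2 * dl ->
    (\int[mu]_(x in `]a, b[) (W (t, x))%:E <= (e / C)%:E)%E.
    by move=> t1 t2; apply: ht0; lra.
  move=> /(_ h) H.
  apply: (@le_trans _ _ (2 * (b - a) ^+ 4 * (e / C))%:E); last first.
    rewrite lee_fin mulrA ler_pdivrMr // mulrC ler_wpM2l ?(ltW e0) //.
    by rewrite /C lerDl.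
  apply: le_trans H; apply: ge0_le_integral => //.
  - by move=> z _; exact: P0e.
  - apply/measurable_EFinP; apply: measurable_funM; first exact: measurable_ramp_fst.
    by apply: measurable_funM => //; exact: measurable_cone_gap.
  move=> z _; rewrite lee_fin /P indicE; have wg : 0 <= W z * cone_gap z.
    by rewrite mulr_ge0 // cone_gap_ge0.
  apply: ler_wpM2r => //; case: (boolP (z.1 \in _)) => hz; last first.
    by have /andP[] := ramp_bounds z.1 d0.
  rewrite ramp1 //; move: hz; rewrite inE /= in_itv /= andbT => hz.
  exact: (le_trans dtau (ltW hz)).
have iPt : (\int[mu]_t `|fubini_F mu (EFin \o P) t| = 0)%E.
  rewrite -[RHS]iP (@fubini_tonelli1 _ _ _ _ _ mu mu (EFin \o P)) //.
  by apply: eq_integral => t _; rewrite gee0_abs //; exact: integral_ge0.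
have mF : measurable_fun setT (fubini_F mu (EFin \o P)).
  by apply: (@measurable_fun_fubini_tonelli_F _ _ _ _ _ mu).
have aeF := (ae_eq_integral_abs mu measurableT mF).1 iPt.
apply: (ae_imp aeF) => t /= /(_ I) Ft0 taut.
have mPt : measurable_fun setT (fun x => (P (t, x))%:E).
  apply/measurable_EFinP.
  by apply: (measurableT_comp (f := P)) => //; exact: pair1_measurable.
have iPx : (\int[mu]_x `|(P (t, x))%:E| = 0)%E.
  rewrite -[RHS]Ft0; apply: eq_integral => x _; rewrite gee0_abs //.
  by rewrite lee_fin.
have aeP := (ae_eq_integral_abs mu measurableT mPt).1 iPx.
apply: (ae_imp aeP) => x /= /(_ I) [] + x1 x2.
rewrite /P /= indicE mem_set /=; last by rewrite in_itv /= taut.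
rewrite mul1r => /eqP; rewrite mulf_eq0 => /orP[/eqP //|].
by rewrite gt_eqF // cone_gap_gt0.
Qed.

End cone_estimate.

(** * Lebesgue spaces and fluxes on the real line *)

Section real_line.
Context {R : realType}.
Local Notation mu := (@lebesgue_measure R).
Implicit Types (u v w : R -> R).

Lemma ae_exists_itv (P : R -> Prop) (a b : R) : a < b ->
  (\forall x \ae mu, P x) -> exists2 x, a < x < b & P x.
Proof.
move=> ab aeP; apply: contrapT => nP.
have sub : `]a, b[%classic `<=` ~` [set x | P x].
  by move=> x /= xab Px; apply: nP; exists x.
have I0 : mu (`]a, b[%classic : set R) = 0%E.
  have [N [mN N0 PN]] := aeP.
  apply: (@subset_measure0 _ _ _ mu _ N); [exact: measurable_itv|exact: mN| |exact: N0].
  exact: subset_trans sub PN.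
move: I0; rewrite (lebesgue_measure_itv `]a, b[%R) /= lte_fin ab -EFinB => -[].
by lra.
Qed.

Lemma lebesgue_measure_setT_gt0 : (0 < mu [set: R])%E.
Proof.
have I1 : mu (`[0, 1]%classic : set R) = 1%E.
  by rewrite (lebesgue_measure_itv `[0, 1]%R) /= lte_fin ltr01 -EFinB subr0.
apply: (@lt_le_trans _ _ (mu (`[0, 1]%classic : set R))).
  by rewrite I1 lte_fin.
by apply: le_measure; rewrite ?inE //; exact: measurable_itv.
Qed.

Lemma Linfty_norm_leP v (C : R) :
  (Linfty_norm v <= C%:E)%E -> \forall x \ae mu, `|v x| <= C.
Proof.
rewrite /Linfty_norm unlock lebesgue_measure_setT_gt0 => /ess_supP h.
by apply: (ae_imp h) => x; rewrite /= lee_fin.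
Qed.

(** The open sets in the definition form an uncountable family. Intervals with rational ends refine
    it to a countable one: [P p] is vanishing on the interval [p], and [Q] runs through the codes of
    such pairs. *)
Lemma ess_support_ae0 v (A : set R) : ess_support v `<=` A ->
  \forall x \ae mu, ~ A x -> v x = 0.
Proof.
move=> vA.
pose P (p : rat * rat) (x : R) := ratr p.1 < x -> x < ratr p.2 -> v x = 0.
pose Q (n : nat) (x : R) := forall p : rat * rat, unpickle n = Some p ->
  (\forall y \ae mu, P p y) -> P p x.
have aeQ n : \forall x \ae mu, Q n x.
  rewrite /Q; case: (unpickle n) => [p|]; last by apply: aeW => x p.
  have [h|h] := pselect (\forall y \ae mu, P p y).
    by apply: (ae_imp h) => x Px p' [<-].
  by apply: aeW => x p' [<-].
apply: (ae_imp (ae_foralln aeQ)) => x {}aeQ nAx.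
have nx : ~ ess_support v x by move=> /vA.
have [U [oU vU] Ux] := contrapT nx.
have := oU; rewrite openE => /(_ x Ux) /nbhs_ballP[e /= e0 eU].
have xe1 : x - e < x by lra.
have xe2 : x < x + e by lra.
have [q1 q1P] := rat_in_itvoo xe1; have [q2 q2P] := rat_in_itvoo xe2.
move: q1P q2P; rewrite !in_itv /= => /andP[q11 q12] /andP[q21 q22].
apply: (aeQ (pickle (q1, q2)) (q1, q2)) => //; first by rewrite pickleK.
apply: (ae_imp vU) => y vy /= y1 y2; apply: vy; apply: eU.
by rewrite /ball /= ltr_norml; apply/andP; split; lra.
Qed.

Lemma lipschitz_of_derive1 (f : R -> R) (M c x y : R) :
  (forall v : R, derivable f v 1) ->
  (forall v : R, `|v| <= M -> `|derive1 f v| <= c) ->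
  `|x| <= M -> `|y| <= M -> `|f x - f y| <= c * `|x - y|.
Proof.
move=> df fc; wlog xy : x y / y <= x => [hw|].
  have [xy|/ltW xy] := leP y x; first exact: hw.
  by move=> xM yM; rewrite distrC [X in _ * X]distrC; apply: hw.
move=> xM yM.
have cf : {within `[y, x], continuous f}.
  apply: continuous_subspaceT => z; apply: differentiable_continuous.
  by apply/derivable1_diffP; exact: df.
have dfx z : z \in `]y, x[ -> is_derive z 1 f (derive1 f z).
  by move=> _; rewrite derive1E; apply: derivableP; exact: df.
have [z zyx ->] := MVT_segment xy dfx cf.
rewrite normrM ler_wpM2r //; apply: fc.
move: zyx xM yM; rewrite in_itv /= !ler_norml => /andP[? ?] /andP[? ?] /andP[? ?].
by apply/andP; split; lra.
Qed.

(** The extreme value theorem for [|f'|] on [[- M, M]] bounds the set, so that its [sup] is an upper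
    bound. *)
Lemma derive1_le_max_speed (f : R -> R) (M v : R) : smooth f -> 0 < M ->
  `|v| <= M -> `|derive1 f v| <= max_speed f M.
Proof.
move=> sf M0 vM.
have cf' : continuous (fun x : R => `|derive1 f x|).
  move=> x; apply: (@continuous_comp _ _ _ (derive1 f)); last exact: norm_continuous.
  apply: differentiable_continuous; apply/derivable1_diffP; exact: (sf 1%N).
have [k _ hk] := @EVT_max R (fun x => `|derive1 f x|) (- M) M (ltac:(lra))
  (continuous_subspaceT cf').
apply: sup_upper_bound; last by exists v.
split; first by exists `|derive1 f v|, v.
exists `|derive1 f k| => _ [w /= wM <-]; apply: hk.
by rewrite in_itv /= -ler_norml.
Qed.

Lemma max_speed_ge0 (f : R -> R) (M : R) : smooth f -> 0 < M -> 0 <= max_speed f M.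
Proof.
move=> sf M0; apply: le_trans (@derive1_le_max_speed f M 0 sf M0 _); first exact: normr_ge0.
by rewrite normr0 ltW.
Qed.

Lemma L1_distC v w : L1_dist v w = L1_dist w v.
Proof.
rewrite /L1_dist !Lnorm1; apply: eq_integral => x _ /=.
by rewrite distrC.
Qed.

Lemma bounded_support_L1 v (C L : R) : measurable_fun setT v ->
  (\forall x \ae mu, `|v x| <= C) ->
  (\forall x \ae mu, ~ (`[- L, L]%classic x) -> v x = 0) -> in_L1 v.
Proof.
move=> mv vC v0; apply/in_L1P; apply/integrableP; split; first exact/measurable_EFinP.
pose B : set R := `[- L, L]%classic.
have mB : measurable B by exact: measurable_itv.
have iB := @integrable_indic_itv R (- L) L true false.
have iCB : mu.-integrable setT (fun x => (`|C|)%:E * (\1_B x)%:E)%E.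
  by apply: integrableZl => //; exact: iB.
apply: le_lt_trans (_ : (\int[mu]_x ((`|C|)%:E * (\1_B x)%:E) < +oo)%E); last first.
  by have := integrable_fin_num measurableT iCB; rewrite fin_numElt => /andP[].
apply: ae_ge0_le_integral => //.
- by apply: measurableT_comp => //; exact/measurable_EFinP.
- exact: measurable_int iCB.
apply: (ae_imp2 vC v0) => x {}vC {}v0 _ /=; rewrite -EFinM lee_fin indicE.
case: (boolP (x \in B)) => xB.
  by rewrite mulr1 (le_trans vC) // ler_norm.
rewrite v0 ?normr0 ?mulr0 // => xB'; move: xB; rewrite notin_setE; exact.
Qed.

End real_line.

(** * Entropy solutions *)

Section truncation.
Context {R : realType}.
Local Notation mu := (@lebesgue_measure R).
Local Notation mu2 := (mu \x mu)%E.
Implicit Types (C v : R) (u : R -> R -> R) (z : R * R).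

Definition clamp C v : R := Num.max (- C) (Num.min v C).

Lemma norm_clamp C v : 0 <= C -> `|clamp C v| <= C.
Proof.
move=> C0; rewrite /clamp ler_norml le_max lexx ge_max ge_min lexx orbT !andbT.
by lra.
Qed.

Lemma clamp_id C v : `|v| <= C -> clamp C v = v.
Proof. by rewrite ler_norml => /andP[h1 h2]; rewrite /clamp min_l // max_r. Qed.

Lemma measurable_clamp C : measurable_fun setT (clamp C).
Proof. by apply: measurable_maxr => //; exact: measurable_minr. Qed.

Lemma measurable_half_plane : measurable (half_plane : set (R * R)).
Proof.
have mf : measurable_fun setT (@fst R R) by exact: measurable_fst.
have mI : measurable (`]0, +oo[%classic : set R) by exact: measurable_itv.
have := mf measurableT _ mI; rewrite setTI.
by congr measurable; apply/seteqP; split => z; rewrite /half_plane /= in_itv /= andbT.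
Qed.

(* Equal almost everywhere to [u] on the half plane when [C] bounds [u], but
   bounded and measurable everywhere; it is 0 for nonpositive times. *)
Definition plane_fun C u : R * R -> R :=
  (fun z => clamp C (u z.1 z.2)) \_ half_plane.

Lemma norm_plane_fun C u z : 0 <= C -> `|plane_fun C u z| <= C.
Proof.
by move=> C0; rewrite /plane_fun patchE; case: ifP => _; rewrite ?norm_clamp ?normr0.
Qed.

Lemma plane_funE C u t x : 0 < t -> plane_fun C u (t, x) = clamp C (u t x).
Proof. by move=> t0; rewrite /plane_fun patchE mem_set. Qed.

Lemma measurable_plane_fun C u :
  measurable_fun half_plane (fun z : R * R => u z.1 z.2) ->
  measurable_fun setT (plane_fun C u).
Proof.
move=> mu_; apply/(measurable_restrictT _ measurable_half_plane).
exact: (measurableT_comp (measurable_clamp C) mu_).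
Qed.

(** The bound on [u] holds for almost every [x] at each time, which need not give a null set of the
    plane by itself; joint measurability of [u] makes the exceptional set [N] measurable, and it is
    null because all its time sections are. *)
Lemma half_plane_integral_plane_fun C u (A B : R -> R) (F G : R * R -> R) :
  measurable_fun half_plane (fun z : R * R => u z.1 z.2) ->
  (forall t, 0 < t -> \forall x \ae mu, `|u t x| <= C) ->
  measurable_fun setT A -> measurable_fun setT B ->
  measurable_fun setT F -> measurable_fun setT G ->
  (forall z, ~ half_plane z -> F z = 0 /\ G z = 0) ->
  half_plane_integral (fun z => A (u z.1 z.2) * F z + B (u z.1 z.2) * G z) =
  (\int[mu2]_z (A (plane_fun C u z) * F z + B (plane_fun C u z) * G z))%R.
Proof.
move=> mu_ uC mA mB mF mG FG0.
have mH := measurable_half_plane.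
rewrite /half_plane_integral Rintegral_mkcond /Rintegral; congr fine.
have mp := measurable_plane_fun C mu_.
apply: ae_eq_integral => //.
- apply/measurable_EFinP; apply/(measurable_restrictT _ mH).
  apply: measurable_funD; apply: measurable_funM; try exact: measurable_funTS.
    exact: (measurableT_comp mA mu_).
  exact: (measurableT_comp mB mu_).
- apply/measurable_EFinP; apply: measurable_funD; apply: measurable_funM => //.
    exact: (measurableT_comp mA mp).
  exact: (measurableT_comp mB mp).
pose h z := `|u z.1 z.2|.
have mh : measurable_fun half_plane h by exact: (measurableT_comp (@normr_measurable _ setT) mu_).
pose N : set (R * R) := half_plane `&` h @^-1` `]C, +oo[%classic.
have mN : measurable N by apply: mh => //; exact: measurable_itv.
exists N; split; first exact: mN.
  apply: prod_measure_eq0 => // t.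
  have [t0|t0] := ltP 0 t; last first.
    rewrite (_ : xsection N t = set0) ?measure0 //.
    apply/seteqP; split => // x; rewrite /xsection /= inE => -[].
    by rewrite /half_plane /= => /lt_geF; rewrite t0.
  have [N' [mN' N'0 sN']] := uC t t0.
  apply: (@subset_measure0 _ _ _ mu _ N'); [exact: measurable_xsection|exact: mN'| |exact: N'0].
  apply: subset_trans sN' => x; rewrite /xsection /= inE => -[_].
  by rewrite /h /= in_itv /= andbT => /lt_geF ->.
move=> z; apply: contra_notP => nN _ /=.
congr EFin; rewrite patchE; case: ifPn => zH.
  have zC : `|u z.1 z.2| <= C.
    rewrite leNgt; apply/negP => h1; apply: nN; split; first by rewrite inE in zH.
    by rewrite /h /= in_itv /= h1.
  by rewrite /plane_fun patchE zH clamp_id.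
have [|-> ->] := FG0 z; last by rewrite !mulr0 addr0.
by move=> zH'; move: zH; rewrite notin_setE; exact.
Qed.

End truncation.

(** * Vanishing of an entropy in a backward cone *)

Section entropy_cone.
Context {R : realType}.
Local Notation mu := (@lebesgue_measure R).
Local Notation mu2 := (mu \x mu)%E.
Variables (u : R -> R -> R) (C : R) (eta q : R -> R) (a b c : R).
Hypotheses (C_ge0 : 0 <= C) (c_gt0 : 0 < c).
Hypothesis u_meas : measurable_fun half_plane (fun z : R * R => u z.1 z.2).
Hypothesis u_bound : forall t, 0 <= t -> \forall x \ae mu, `|u t x| <= C.
Hypothesis u_L1 : forall t, 0 <= t -> in_L1 (u t).
Hypothesis u_cont : forall t, 0 <= t ->
  L1_dist (u s) (u t) @[s --> within [set s : R | 0 <= s] (nbhs t)] --> 0%E.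
Hypotheses (eta_ge0 : forall v, 0 <= eta v)
  (eta_lip : forall v w, `|eta v - eta w| <= 2 * `|v - w|)
  (eta_meas : measurable_fun setT eta) (q_meas : measurable_fun setT q)
  (q_le : forall v, `|v| <= C -> `|q v| <= c * eta v).
Hypothesis eta_entropy : forall dl : R, 0 < dl ->
  0 <= (\int[mu2]_z (eta (plane_fun C u z) * cone_dt a b c dl z +
                     q (plane_fun C u z) * cone_dx a b c dl z))%R.
Hypothesis eta_init : \forall x \ae mu, a < x < b -> eta (u 0 x) = 0.

Lemma L1_dist_near (t kappa : R) : 0 <= t -> 0 < kappa ->
  exists2 e : R, 0 < e & forall s, 0 <= s -> `|t - s| < e ->
    (L1_dist (u s) (u t) < kappa%:E)%E.
Proof.
move=> t0 k0.
have nk : nbhs (0%E : \bar R) [set y | (y < kappa%:E)%E].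
  by apply: open_ereal_lt'; rewrite lte_fin.
have := u_cont t0 nk; rewrite /= /within /= => /nbhs_ballP[e /= e0 he].
by exists e => // s s0 ts; apply: he.
Qed.

(** On [A] the term [eta (w x)] is 0, so [eta (v x)] is at most [2 * |v x - w x|]. *)
Lemma integral_eta_le (v w : R -> R) (A : set R) : measurable A ->
  in_L1 v -> in_L1 w -> (\forall x \ae mu, A x -> eta (w x) = 0) ->
  (\int[mu]_(x in A) (eta (v x))%:E <= 2%:E * L1_dist v w)%E.
Proof.
move=> mA /in_L1_measurable mv /in_L1_measurable mw ew.
rewrite /L1_dist Lnorm1.
have md : measurable_fun setT (fun x => `|(v \- w) x|).
  by apply: measurableT_comp => //; exact: measurable_funB.
have mde : measurable_fun setT (fun x => (`|(v \- w) x|)%:E).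
  exact/measurable_EFinP.
have md2 : measurable_fun setT (fun x => (2 * `|(v \- w) x|)%:E).
  by apply/measurable_EFinP; exact: measurable_funM.
have mev : measurable_fun setT (fun x => (eta (v x))%:E).
  by apply/measurable_EFinP; exact: measurableT_comp.
rewrite -ge0_integralZl //.
apply: (@le_trans _ _ (\int[mu]_(x in A) (2%:E * `|(EFin \o (v \- w)%R) x|))%E).
  apply: ae_ge0_le_integral => //.
  - by move=> x _; rewrite lee_fin.
  - exact: (measurable_funTS mev).
  - exact: (measurable_funTS md2).
  apply: (ae_imp ew) => x {}ew Ax /=.
  have := eta_lip (v x) (w x); rewrite (ew Ax) subr0 => h.
  by rewrite lee_fin (le_trans (ler_norm _)).
by apply: ge0_subset_integral.
Qed.

Lemma cone_initial_vanish (kappa : R) : 0 < kappa -> exists2 t0 : R, 0 < t0 &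
  forall t, 0 < t -> t <= t0 ->
    (\int[mu]_(x in `]a, b[) (eta (plane_fun C u (t, x)))%:E <= kappa%:E)%E.
Proof.
move=> k0; have k2 : 0 < kappa / 2 by lra.
have [e e0 he] := L1_dist_near (lexx 0) k2.
exists (e / 2) => [|t t0 te]; first lra.
have ut := u_bound (ltW t0).
have mab : measurable (`]a, b[%classic : set R) by exact: measurable_itv.
have mut := in_L1_measurable (u_L1 (ltW t0)).
apply: (@le_trans _ _ (\int[mu]_(x in `]a, b[) (eta (u t x))%:E)%E).
  apply: ae_ge0_le_integral => //.
  - by move=> x _; rewrite lee_fin.
  - have mp := measurable_plane_fun C u_meas.
    have mpt : measurable_fun setT (fun x => plane_fun C u (t, x)).
      by apply: (measurableT_comp mp); exact: pair1_measurable.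
    have m1 : measurable_fun setT (fun x => eta (plane_fun C u (t, x))).
      exact: (measurableT_comp eta_meas mpt).
    by apply: measurable_funTS; apply/measurable_EFinP; exact: m1.
  - by move=> x _; rewrite lee_fin.
  - have m1 : measurable_fun setT (fun x => eta (u t x)).
      exact: (measurableT_comp eta_meas mut).
    by apply: measurable_funTS; apply/measurable_EFinP; exact: m1.
  by apply: (ae_imp ut) => x utx _; rewrite plane_funE // clamp_id.
have ab0 : \forall x \ae mu, `]a, b[%classic x -> eta (u 0 x) = 0.
  by apply: (ae_imp eta_init) => x h /=; rewrite in_itv; exact: h.
apply: (le_trans (integral_eta_le mab (u_L1 (ltW t0)) (u_L1 (lexx 0)) ab0)).
have d0 : (L1_dist (u t) (u 0) <= (kappa / 2)%:E)%E.
  by apply: ltW; apply: he; [lra|rewrite sub0r normrN gtr0_norm //; lra].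
rewrite (_ : kappa = 2 * (kappa / 2)); last lra.
by rewrite EFinM; apply: lee_wpmul2l => //; rewrite lee_fin.
Qed.

(** [cone_vanish] settles almost every time only. Such times [s < t] accumulate at [t]; the section
    of the cone at [s] contains the one at [t], and continuity in L^1 carries the vanishing over. *)
Lemma entropy_cone_vanish (t : R) : 0 < t ->
  \forall x \ae mu, a + c * t < x < b - c * t -> eta (u t x) = 0.
Proof.
move=> t0.
pose A : set R := `]a + c * t, b - c * t[%classic.
have mA : measurable A by exact: measurable_itv.
have mp := measurable_plane_fun C u_meas.
have pC z := norm_plane_fun u z C_ge0.
have t2 : 0 < t / 2 by lra.
have good : \forall s \ae mu, t / 2 < s -> \forall x \ae mu, a + c * s < x ->
    x < b - c * s -> eta (plane_fun C u (s, x)) = 0.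
  apply: (@cone_vanish R a b c (eta 0 + 2 * C) (fun z => eta (plane_fun C u z))
      (fun z => q (plane_fun C u z)) c_gt0) => //.
  - exact: (measurableT_comp eta_meas mp).
  - exact: (measurableT_comp q_meas mp).
  - move=> z; have := eta_lip (plane_fun C u z) 0; have := pC z.
    by rewrite subr0 => h1 /(le_trans (ler_norm _)); lra.
  - by move=> z; exact: q_le.
  - exact: cone_initial_vanish.
have mut := in_L1_measurable (u_L1 (ltW t0)).
have mev : measurable_fun setT (fun x => (eta (u t x))%:E).
  by apply/measurable_EFinP; exact: measurableT_comp.
have i0 : (\int[mu]_(x in A) `|(eta (u t x))%:E| = 0)%E.
  apply/eqP; rewrite eq_le integral_ge0 ?andbT //.
  apply/lee_addgt0Pr => k k0; rewrite add0e.
  have k2 : 0 < k / 2 by lra.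
  have [e e0 he] := L1_dist_near (ltW t0) k2.
  have st : Num.max (t / 2) (t - e) < t by rewrite gt_max; apply/andP; split; lra.
  have [s /andP[]] := ae_exists_itv st good; rewrite gt_max => /andP[s1 s2] s3 gs.
  have s0 : 0 < s by lra.
  have us : \forall x \ae mu, A x -> eta (u s x) = 0.
    apply: (ae_imp2 (gs s1) (u_bound (ltW s0))) => x hx ux; rewrite /A /= in_itv /=.
    move=> /andP[x1 x2]; have cs : c * s <= c * t by rewrite ler_pM2l // ltW.
    by rewrite -hx ?plane_funE ?clamp_id //; lra.
  under eq_integral do rewrite gee0_abs ?lee_fin //.
  apply: (le_trans (integral_eta_le mA (u_L1 (ltW t0)) (u_L1 (ltW s0)) us)).
  rewrite L1_distC.
  have d0 : (L1_dist (u s) (u t) <= (k / 2)%:E)%E.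
    by apply: ltW; apply: he; [lra|rewrite gtr0_norm; lra].
  rewrite (_ : k = 2 * (k / 2)); last lra.
  by rewrite EFinM; apply: lee_wpmul2l => //; rewrite lee_fin.
have := (ae_eq_integral_abs mu mA (measurable_funTS mev)).1 i0.
by move=> ae0; apply: (ae_imp ae0) => x; rewrite /A /= in_itv /= => h /h [].
Qed.

End entropy_cone.

(** * Maximum principle and finite speed of propagation *)

Section kruzhkov.
Context {R : realType}.
Local Notation mu := (@lebesgue_measure R).
Local Notation mu2 := (mu \x mu)%E.
Variables (f u0 : R -> R) (u : R -> R -> R).
Hypothesis f_smooth : smooth f.
Hypothesis u_sol : entropy_solution f u0 u.

Definition kflux (k v : R) : R := Num.sg (v - k) * (f v - f k).

Lemma derivable_flux (v : R) : derivable f v 1.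
Proof. by have := @f_smooth 0%N v; rewrite /derive1n. Qed.

Lemma measurable_flux : measurable_fun setT f.
Proof.
apply: continuous_measurable_fun => x; apply: differentiable_continuous.
by apply/derivable1_diffP; exact: derivable_flux.
Qed.

Lemma measurable_kflux k : measurable_fun setT (kflux k).
Proof.
(* This form replaces the discontinuous sign by compositions with the continuous [f]. *)
have -> : kflux k = fun v => f (Num.max v k) - f (Num.min v k).
  apply/funext => v; rewrite /kflux; case: (ltrgtP v k) => [vk|vk|->].
  - by rewrite ltr0_sg ?subr_lt0 // mulN1r opprB.
  - by rewrite gtr0_sg ?subr_gt0 // mul1r.
  - by rewrite subrr sgr0 mul0r subrr.
apply: measurable_funB; apply: (measurableT_comp measurable_flux).
  exact: measurable_maxr.
exact: measurable_minr.
Qed.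

Lemma norm_kflux (k v C c : R) : (forall w, `|w| <= C -> `|derive1 f w| <= c) ->
  `|v| <= C -> `|k| <= C -> `|kflux k v| <= c * `|v - k|.
Proof.
move=> fc vC kC; have := lipschitz_of_derive1 derivable_flux fc vC kC.
apply: le_trans; rewrite /kflux normrM normr_sg ler_piMl //.
by case: (_ == _).
Qed.

Lemma kruzhkov_cone (C k a b c dl : R) : 0 < c -> 0 < dl ->
  (forall t, 0 < t -> \forall x \ae mu, `|u t x| <= C) ->
  0 <= (\int[mu2]_z (`|plane_fun C u z - k| * cone_dt a b c dl z +
                     kflux k (plane_fun C u z) * cone_dx a b c dl z))%R.
Proof.
move=> c0 d0 uC; have [u_meas _ _ _ [_ kr]] := u_sol.
have := kr k _ (test_function_cone a b c0 d0) (cone_fun_ge0 a b c d0).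
rewrite partial_t_cone // partial_x_cone //.
rewrite (@half_plane_integral_plane_fun R C u (fun v => `|v - k|) (kflux k)
  (cone_dt a b c dl) (cone_dx a b c dl)) //.
- apply: measurableT_comp => //; exact: measurable_funB.
- exact: measurable_kflux.
- exact: measurable_cone_dt.
- exact: measurable_cone_dx.
move=> z zH; have [] // := @cone_support _ a b c dl c0 d0 z.
move=> [/=]; rewrite in_itv /= => /andP[h _] _; apply: zH.
exact: lt_le_trans d0 h.
Qed.

Lemma entropy_solution_ae_bound : exists2 C : R, 0 <= C &
  forall t, 0 <= t -> \forall x \ae mu, `|u t x| <= C.
Proof.
have [_ [C uC] _ _ _] := u_sol; exists `|C| => // t t0.
apply: (ae_imp (Linfty_norm_leP (uC t t0))) => x /le_trans; apply.
exact: ler_norm.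
Qed.

(** The a priori bound is enlarged to [C = C1 + M] so that the constants [M] and [- M] of the
    Kruzhkov entropies lie in the range over which the slope [c] controls [f']. *)
Lemma maximum_principle (M : R) : 0 < M ->
  (\forall x \ae mu, `|u0 x| <= M) ->
  forall t, 0 <= t -> \forall x \ae mu, `|u t x| <= M.
Proof.
move=> M0 u0M t; have [u_meas _ [u_L1 u_cont] u_init _] := u_sol.
have uM0 : \forall x \ae mu, `|u 0 x| <= M.
  by apply: (ae_imp2 u0M u_init) => x h ->.
rewrite le_eqVlt => /predU1P[<- //|t0].
have [C1 C10 uC1] := entropy_solution_ae_bound.
pose C := C1 + M; have C0 : 0 < C by rewrite /C; lra.
have MC : `|M| <= C by rewrite gtr0_norm // /C; lra.
have NMC : `|- M| <= C by rewrite normrN.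
have uC s : 0 <= s -> \forall x \ae mu, `|u s x| <= C.
  by move=> s0; apply: (ae_imp (uC1 s s0)) => x h; rewrite /C; lra.
have fC w : `|w| <= C -> `|derive1 f w| <= max_speed f C.
  exact: derive1_le_max_speed.
pose c := max_speed f C + 1.
have c0 : 0 < c by have := max_speed_ge0 f_smooth C0; rewrite /c; lra.
have fc w : `|w| <= C -> `|derive1 f w| <= c by move=> /fC; rewrite /c; lra.
have lip x y : `|x| <= C -> `|y| <= C -> `|f x - f y| <= c * `|x - y|.
  exact: lipschitz_of_derive1 derivable_flux fc.
(* [eta] vanishes exactly on [-M, M], where its flux [q] vanishes as well. *)
pose eta v : R := `|v - M| + `|v + M| - 2 * M.
pose q v : R := kflux M v + kflux (- M) v - (f M - f (- M)).
have eta_ge0 v : 0 <= eta v.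
  rewrite /eta subr_ge0; have := ler_normB (v + M) (v - M).
  rewrite (_ : v + M - (v - M) = 2 * M); last by ring.
  by rewrite (@ger0_norm _ (2 * M)); lra.
have eta0 v : eta v = 0 -> `|v| <= M.
  rewrite /eta ler_norml.
  by case: (ger0P (v - M)) => h1; case: (ger0P (v + M)) => h2 h; apply/andP; split; lra.
have eta_in v : `|v| <= M -> eta v = 0.
  rewrite /eta ler_norml => /andP[h1 h2].
  by rewrite ler0_norm ?ger0_norm; lra.
have eta_lip v w : `|eta v - eta w| <= 2 * `|v - w|.
  have -> : eta v - eta w = (`|v - M| - `|w - M|) + (`|v + M| - `|w + M|).
    by rewrite /eta; lra.
  apply: (le_trans (ler_normD _ _)); rewrite mulr_natl mulr2n; apply: lerD.
    by apply: (le_trans (ler_dist_dist _ _)); rewrite opprB addrA subrK.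
  by apply: (le_trans (ler_dist_dist _ _)); rewrite opprD addrACA subrr addr0.
have eta_meas : measurable_fun setT eta.
  apply: measurable_funB => //; apply: measurable_funD;
    apply: measurableT_comp => //; [exact: measurable_funB|exact: measurable_funD].
have q_meas : measurable_fun setT q.
  apply: measurable_funB => //.
  by apply: measurable_funD; exact: measurable_kflux.
have q_le v : `|v| <= C -> `|q v| <= c * eta v.
  move=> vC; have [vM|vM] := lerP `|v| M.
    rewrite eta_in // mulr0 (_ : q v = 0) ?normr0 // /q /kflux opprK.
    move: vM; rewrite ler_norml => /andP[h1 h2].
    have s1 : Num.sg (v - M) * (f v - f M) = f M - f v.
      move: h2; rewrite le_eqVlt => /predU1P[->|h2]; first by rewrite !subrr mulr0.
      by rewrite ltr0_sg ?subr_lt0 // mulN1r opprB.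
    have s2 : Num.sg (v + M) * (f v - f (- M)) = f v - f (- M).
      move: h1; rewrite le_eqVlt => /predU1P[<-|h1]; first by rewrite !subrr mulr0.
      by rewrite gtr0_sg ?mul1r //; lra.
    by rewrite s1 s2; ring.
  (* Outside [[- M, M]] the two signs agree: [eta] is twice the distance to the nearer end, and [q]
     is up to sign twice the increment of [f] from that end. *)
  move: vM; rewrite ltr_normr => /orP[vM|vM].
    rewrite /q /kflux opprK !gtr0_sg; [|lra..].
    have -> : 1 * (f v - f M) + 1 * (f v - f (- M)) - (f M - f (- M)) =
      2 * (f v - f M) by ring.
    have -> : eta v = 2 * `|v - M|.
      by rewrite /eta !gtr0_norm; lra.
    rewrite normrM ger0_norm // mulrCA ler_wpM2l //; exact: lip.
  rewrite /q /kflux opprK !ltr0_sg; [|lra..].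
  have -> : -1 * (f v - f M) + -1 * (f v - f (- M)) - (f M - f (- M)) =
    - 2 * (f v - f (- M)) by ring.
  have -> : eta v = 2 * `|v - (- M)|.
    by rewrite /eta opprK !ltr0_norm; lra.
  rewrite mulNr normrN normrM (@ger0_norm _ 2) // mulrCA ler_wpM2l //; exact: lip.
have ent a b dl : 0 < dl ->
    0 <= (\int[mu2]_z (eta (plane_fun C u z) * cone_dt a b c dl z +
                       q (plane_fun C u z) * cone_dx a b c dl z))%R.
  move=> d0.
  have uCt s : 0 < s -> \forall x \ae mu, `|u s x| <= C by move=> /ltW; exact: uC.
  have e1 := @kruzhkov_cone C M a b c dl c0 d0 uCt.
  have e2 := @kruzhkov_cone C (- M) a b c dl c0 d0 uCt.
  have mp := measurable_plane_fun C u_meas.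
  have pC z := norm_plane_fun u z (ltW C0).
  have mabs k : measurable_fun setT (fun z => `|plane_fun C u z - k|).
    by apply: measurableT_comp => //; exact: measurable_funB.
  have mkf k : measurable_fun setT (fun z => kflux k (plane_fun C u z)).
    exact: (measurableT_comp (measurable_kflux k) mp).
  have babs k z : `|k| <= C -> `|(`|plane_fun C u z - k|)| <= 2 * C.
    move=> kC; rewrite normr_id; apply: (le_trans (ler_normB _ _)).
    by have := pC z; lra.
  have bkf k z : `|k| <= C -> `|kflux k (plane_fun C u z)| <= c * (2 * C).
    move=> kC; apply: (le_trans (norm_kflux fc (pC z) kC)).
    by rewrite ler_pM2l // -[leLHS]normr_id; exact: babs.
  have i k : `|k| <= C -> mu2.-integrable setT (EFin \o
      (fun z => `|plane_fun C u z - k| * cone_dt a b c dl z +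
                kflux k (plane_fun C u z) * cone_dx a b c dl z)).
    move=> kC; apply: (@integrable_cone_comb _ a b c dl (2 * C) (c * (2 * C))) => //.
      by move=> z; exact: babs.
    by move=> z; exact: bkf.
  have it := integrable_cone_dt a b c0 d0.
  have ix := integrable_cone_dx a b c0 d0.
  pose I1 z := `|plane_fun C u z - M| * cone_dt a b c dl z +
    kflux M (plane_fun C u z) * cone_dx a b c dl z.
  pose I2 z := `|plane_fun C u z + M| * cone_dt a b c dl z +
    kflux (- M) (plane_fun C u z) * cone_dx a b c dl z.
  pose I3 z := (2 * M) * cone_dt a b c dl z.
  pose I4 z := (f M - f (- M)) * cone_dx a b c dl z.
  have i1 : mu2.-integrable setT (EFin \o I1) by exact: i.
  have i2 : mu2.-integrable setT (EFin \o I2).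
    have := i (- M) NMC; congr (integrable _ _ (EFin \o _)).
    by apply/funext => z; rewrite opprK.
  have iZ (k : R) (F : R * R -> R) : mu2.-integrable setT (EFin \o F) ->
      mu2.-integrable setT (EFin \o (fun z => k * F z)).
    move=> iF; have := @integrableZl _ _ _ mu2 setT measurableT k _ iF; exact.
  have i3 : mu2.-integrable setT (EFin \o I3) by exact: iZ.
  have i4 : mu2.-integrable setT (EFin \o I4) by exact: iZ.
  have iD (F G : R * R -> R) : mu2.-integrable setT (EFin \o F) ->
      mu2.-integrable setT (EFin \o G) ->
      mu2.-integrable setT (EFin \o (fun z => F z + G z)).
    by move=> iF iG; have := integrableD measurableT iF iG; exact.
  have i12 := iD _ _ i1 i2; have i34 := iD _ _ i3 i4.
  (* [I1] and [I2] are the Kruzhkov integrands for [M] and [- M]; [I3] and [I4] collect the additive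
     constants and integrate to 0. *)
  have -> : (\int[mu2]_z (eta (plane_fun C u z) * cone_dt a b c dl z +
      q (plane_fun C u z) * cone_dx a b c dl z))%R =
      (\int[mu2]_z ((I1 z + I2 z) - (I3 z + I4 z)))%R.
    apply: eq_Rintegral => z _; rewrite /eta /q /I1 /I2 /I3 /I4; ring.
  have E3 : (\int[mu2]_z I3 z)%R = 0.
    by rewrite RintegralZl // /Rintegral integral_cone_dt // mulr0.
  have E4 : (\int[mu2]_z I4 z)%R = 0.
    by rewrite RintegralZl // /Rintegral integral_cone_dx // mulr0.
  rewrite (RintegralB measurableT i12 i34) (RintegralD measurableT i1 i2).
  rewrite (RintegralD measurableT i3 i4) E3 E4 addr0 subr0; apply: addr_ge0 => //.
  by move: e2; congr (_ <= _); apply: eq_Rintegral => z _; rewrite opprK.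
have aen (n : nat) : \forall x \ae mu, - n%:R + c * t < x < n%:R - c * t -> eta (u t x) = 0.
  apply: (@entropy_cone_vanish R u C eta q (- n%:R) n%:R c (ltW C0) c0) => //.
    exact: ent.
  by apply: (ae_imp uM0) => x h _; exact: eta_in.
apply: (ae_imp (ae_foralln aen)) => x h; apply: eta0.
pose n := (Num.truncn (`|x| + c * t)).+1.
have hn : `|x| + c * t < n%:R by exact: truncnS_gt.
apply: (h n); have h1 := ler_norm x; have h2 := ler_norm (- x).
by rewrite normrN in h2; apply/andP; split; lra.
Qed.

Lemma finite_speed (M L : R) : 0 < M -> 
  (\forall x \ae mu, `|u0 x| <= M) ->
  (\forall x \ae mu, ~ (`[- L, L]%classic x) -> u0 x = 0) ->
  forall t, 0 < t -> \forall x \ae mu,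
    L + t * max_speed f M < `|x| -> u t x = 0.
Proof.
move=> M0 u0M u0L t t0; have [u_meas _ [u_L1 u_cont] u_init _] := u_sol.
have uM := maximum_principle M0 u0M.
set ms := max_speed f M.
have ms0 : 0 <= ms by exact: max_speed_ge0.
have fM w : `|w| <= M -> `|derive1 f w| <= ms by exact: derive1_le_max_speed.
have ae_cone (c a b : R) : ms < c -> (forall x, a < x < b -> ~ (`[- L, L]%classic x)) ->
    \forall x \ae mu, a + c * t < x < b - c * t -> `|u t x| = 0.
  move=> msc abL; have c0 : 0 < c by lra.
  apply: (@entropy_cone_vanish R u M (fun v => `|v|) (kflux 0) a b c (ltW M0) c0) => //.
  - move=> v w; apply: (le_trans (ler_dist_dist _ _)).
    by have := normr_ge0 (v - w); lra.
  - exact: measurable_kflux.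
  - move=> v vM; have := @norm_kflux 0 v M ms fM vM _; rewrite normr0 subr0.
    move=> /(_ (ltW M0)) /le_trans; apply; rewrite ler_wpM2r //; lra.
  - move=> dl d0.
    have uMt s : 0 < s -> \forall x \ae mu, `|u s x| <= M by move=> /ltW; exact: uM.
    have := @kruzhkov_cone M 0 a b c dl c0 d0 uMt.
    by congr (_ <= _); apply: eq_Rintegral => z _; rewrite subr0.
  apply: (ae_imp2 u0L u_init) => x h1 -> xab; rewrite h1 ?normr0 //.
  exact: abL.
(* Slopes above [ms] and tending to it: each is positive, and countably many, with cones over []L,
   n[] and []- n, - L[], reach every [x] with [|x| > L + t * ms]. *)
pose c (n : nat) := ms + n.+1%:R^-1.
have msc n : ms < c n by rewrite /c ltrDl invr_gt0 ltr0n.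
have aer n : \forall x \ae mu, L + c n * t < x < n%:R - c n * t -> `|u t x| = 0.
  apply: ae_cone => // x /andP[h1 _] /=; rewrite in_itv /= => /andP[_]; lra.
have ael n : \forall x \ae mu, - n%:R + c n * t < x < - L - c n * t -> `|u t x| = 0.
  apply: ae_cone => // x /andP[_ h1] /=; rewrite in_itv /= => /andP[]; lra.
apply: (ae_imp2 (ae_foralln aer) (ae_foralln ael)) => x {}aer {}ael hx.
pose d := `|x| - (L + t * ms); have d0 : 0 < d by rewrite /d; lra.
(* The first summand pushes the far side of the cone beyond [x]; the second makes [t / n.+1] smaller
   than [d], so the near side stays short of [x]. *)
pose n := (Num.truncn (`|x| + (ms + 1) * t) + Num.truncn (t / d)).+1.
have n1 : `|x| + (ms + 1) * t < n%:R.
  apply: lt_le_trans (truncnS_gt _) _; by rewrite ler_nat ltnS leq_addr.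
have n2 : t / d < n%:R.
  apply: lt_le_trans (truncnS_gt _) _; by rewrite ler_nat ltnS leq_addl.
have nn : n%:R <= n.+1%:R :> R by rewrite ler_nat.
have cn1 : c n * t <= (ms + 1) * t.
  by rewrite ler_wpM2r ?(ltW t0) // lerD2l invf_le1 ?ltr0n // ler1n.
have cn2 : c n * t < ms * t + d.
  rewrite mulrDl ltrD2l mulrC ltr_pdivrMr ?ltr0n // mulrC -ltr_pdivrMr //.
  exact: lt_le_trans nn.
apply/eqP; rewrite -normr_eq0; apply/eqP.
have [x0|x0] := lerP 0 x.
  apply: (aer n); move: n1 cn2; rewrite /d ger0_norm // => n1 cn2.
  by apply/andP; split; lra.
apply: (ael n); move: n1 cn2; rewrite /d ltr0_norm // => n1 cn2.
by apply/andP; split; lra.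
Qed.

End kruzhkov.

(** * The exponent, the count of words, and the entropy bound *)

(** At an inflection point the minimal order exists, so [xget] does not fall back on its default 0;
    one such point bounds the maximum from below. *)
Lemma degeneracy_gt0 (R : realType) (f : R -> R) :
  polynomial_degeneracy f -> (0 < degeneracy f)%N.
Proof.
move=> [finI [w Iw] /(_ w Iw)[p0 [p02 _ fp0]]].
pose P q := (2 <= q)%N && (derive1n q.+1 f w != 0).
have exP : exists q, P q by exists p0; rewrite /P p02 fp0.
have deg2 : (2 <= degeneracy_at f w)%N.
  rewrite /degeneracy_at.
  set A : set nat := [set p : nat | _].
  suff : A (xget 0%N A) by case.
  apply: xgetPex; case: (ex_minnP exP) => m /andP[m2 fm] mmin.
  by exists m; split => // q q2 fq; apply: mmin; rewrite /P q2 fq.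
rewrite /degeneracy fsbig_finite //= (bigD1_seq w) /=; first last.
- exact: finmap.fset_uniq.
- by have := in_fset_set finI w; rewrite mem_set.
by rewrite leq_max (leq_trans _ deg2).
Qed.

(** The factor [3 * log2 5 + log2 (5 * expR 1)] is the binary logarithm of [625 e], which exceeds
    [81 = 3 ^ 4]. *)
Lemma log2_words_le (R : realType) (n : nat) (X : R) : n%:R <= 2 * X ->
  log2 ((3 ^ (4 * n))%:R : R) <= 2 * X * (3 * log2 5 + log2 (5 * expR 1)).
Proof.
move=> nX; have ln2 : 0 < ln (2 : R) by rewrite ln_gt0 // ltr1n.
have e0 : 0 < expR (1 : R) by exact: expR_gt0.
have ln5 : 3 * log2 5 + log2 (5 * expR 1) = ln (625 * expR 1 : R) / ln 2.
  rewrite /log2 mulrA -mulrDl; congr (_ / _).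
  have -> : 625 * expR 1 = 5 ^+ 3 * (5 * expR 1) :> R by ring.
  rewrite [RHS]lnM ?posrE ?exprn_gt0 ?mulr_gt0 //.
  by rewrite lnXn // mulr_natl.
have l81 : ln (81 : R) <= ln (625 * expR 1).
  rewrite ler_ln ?posrE ?mulr_gt0 //.
  by have := expR_ge1Dx (1 : R); lra.
have l0 : 0 <= ln (81 : R) by rewrite ln_ge0 // ler1n.
rewrite ln5 /log2 mulrA ler_pM2r ?invr_gt0 //.
have -> : ((3 ^ (4 * n))%:R : R) = 81 ^+ n by rewrite expnM natrX.
rewrite lnXn // -[ln 81 *+ n]mulr_natl.
apply: (@le_trans _ _ (2 * X * ln 81)); first exact: ler_wpM2r.
by rewrite ler_wpM2l // (le_trans _ nX).
Qed.

Unset Implicit Arguments.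
Set Strict Implicit.

Theorem proposition3p2 (R : realType) (f : R -> R)
    (f_smooth : smooth f) (f_degenerate : polynomial_degeneracy f)
    (L M T : R) (L_gt0 : 0 < L) (M_gt0 : 0 < M) (T_gt0 : 0 < T)
    (S : R -> (R -> R) -> (R -> R)) (S_entropy : entropy_semigroup f S)
    (gamma : R) (gammaP : regularity_constant f S L M gamma) :
  exists2 eps0 : R, 0 < eps0 & forall eps : R, 0 < eps -> eps <= eps0 ->
    (metric_entropy in_L1 L1_dist eps (S T @` data_class L M) <=
     (entropy_constant f T L M gamma / eps ^+ degeneracy f +
      log2 (16 * (L + T * max_speed f M) * M / eps + 1))%:E)%E.
Proof.
have [p pE] : exists p, degeneracy f = p.+1.
  by exists (degeneracy f).-1; rewrite prednK // degeneracy_gt0.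
have [gamma_gt0 gammaTV] := gammaP.
set ms := max_speed f M.
have ms0 : 0 <= ms by exact: max_speed_ge0.
pose ell := L + T * ms.
have ell0 : 0 < ell by rewrite /ell ltr_wpDr // mulr_ge0 // ltW.
pose V := gamma * (1 + T^-1).
have V0 : 0 < V by rewrite mulr_gt0 // addr_gt0 // invr_gt0.
have ell4 : 0 < 4 * ell by rewrite mulr_gt0.
(* The two bounds make [4 * ell / eps] at least 1 and at least [V^-1], hence [X >= 1]; rounding [X]
   up to the integer [n] then at most doubles it. *)
exists (Num.min (4 * ell) (4 * ell * V)) => [|eps eps0].
  by rewrite lt_min ell4 /=; exact: mulr_gt0.
rewrite le_min => /andP[eps1 eps2].
have lam0 : 0 < eps / (4 * ell) by rewrite divr_gt0.
pose X := V * (4 * ell / eps) ^+ p.+1.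
have X1 : 1 <= X.
  have h1 : 1 <= 4 * ell / eps by rewrite ler_pdivlMr // mul1r.
  have h2 : V^-1 <= 4 * ell / eps.
    by rewrite ler_pdivlMr // mulrC ler_pdivrMr // mulrC.
  have : V * V^-1 <= X.
    by rewrite ler_pM2l //; apply: (le_trans h2); exact: ler_eXnr.
  by rewrite mulfV // lt0r_neq0.
pose n := (Num.truncn X).+1.
have Xn : X < n%:R by exact: truncnS_gt.
have nX : n%:R <= 2 * X.
  have : (Num.truncn X)%:R <= X by rewrite truncn_le //; lra.
  by rewrite /n -natr1; lra.
have Vn : V <= n%:R * (eps / (4 * ell)) ^+ p.+1.
  rewrite -ler_pdivrMr ?exprn_gt0 // -exprVn invf_div; exact: ltW.
have cov : Defs.covered_by in_L1 L1_dist eps (S T @` data_class L M) (3 ^ (4 * n)).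
  have cardI : #|{: (4 * n).-tuple (option bool)}| = (3 ^ (4 * n))%N.
    by rewrite card_tuple card_option card_bool.
  rewrite -cardI; apply: (@covered_by_fin R (R -> R) in_L1 L1_dist eps _ _
    (fun w : (4 * n).-tuple (option bool) =>
       step_fun ell (2 * ell / n%:R) (eps / (8 * ell)) n (decode 0 w))).
    by move=> w; exact: step_fun_L1.
  move=> _ [u0 u0D <-].
  have [g [gS gTV]] := gammaTV T u0 T_gt0 u0D.
  have [u0_infty u0_supp u0_norm] := u0D.
  have u0M := Linfty_norm_leP u0_norm.
  have u0L := ess_support_ae0 u0_supp.
  have mu0 : measurable_fun setT u0.
    by move: u0_infty; rewrite /in_Linfty inE => /andP[]; rewrite inE.
  have u0_L1 : in_L1 u0 by exact: bounded_support_L1 mu0 u0M u0L.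
  have u0_sol := S_entropy u0 u0_L1 u0_infty.
  have [_ _ [SL1 _] _ _] := u0_sol.
  have vL1 : in_L1 (S T u0) by exact: SL1 (ltW T_gt0).
  split => //.
  have sp := @finite_speed R f u0 (fun t => S t u0) f_smooth u0_sol M L M_gt0 u0M u0L T T_gt0.
  have v0 : \forall x \ae (@lebesgue_measure R), ~ (`[- ell, ell[%classic x) -> S T u0 x = 0.
    (* The cells are half-open, so the end point [ell] has to be discarded as a null set. *)
    have ne : \forall x \ae (@lebesgue_measure R), x <> ell.
      exists [set ell]; split => //; first exact: lebesgue_measure_set1.
      by move=> x /= /contrapT.
    apply: (ae_imp2 sp ne) => x h xe; rewrite /= in_itv /= => nx; apply: h.
    rewrite -/ms -/ell ltNge; apply/negP; rewrite ler_norml => /andP[h1 h2].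
    by apply: nx; rewrite h1 lt_neqAle h2 andbT; apply/eqP.
  have ell1 : - ell - 1 < - ell by lra.
  have g0 : \forall x \ae (@lebesgue_measure R), x < - ell -> g x = 0.
    apply: (ae_imp2 sp gS) => x h -> xl; apply: h.
    by rewrite -/ms -/ell ltr_normr; apply/orP; right; lra.
  (* [g] agrees with the solution almost everywhere only, so a point where it is exactly 0 has to be
     found. *)
  have [x0 /andP[_ x0l] /(_ x0l) gx0] := ae_exists_itv ell1 g0.
  rewrite pE in gTV.
  have [ks [sks tks] dks] := @frac_TV_step_approx R p n g (S T u0) V ell eps x0 ell0 eps0
    (ltn0Sn _) Vn gTV (in_L1_measurable vL1) gS v0 x0l gx0.
  have [|w wks] := @decode_surj 0 ks (4 * n); first by rewrite sks mulSn leq_add2l.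
  by exists w; rewrite wks.
apply: (metric_entropy_le _ cov); first by rewrite expn_gt0.
apply: (@le_trans _ _ (2 * X * (3 * log2 5 + log2 (5 * expR 1)))).
  exact: log2_words_le.
(* The first term pays for all words; the logarithm is nonnegative, its argument being at least
   1. *)
rewrite -/ms -/ell /entropy_constant -/ms -/ell pE -[leLHS]addr0; apply: lerD; last first.
  rewrite /log2 divr_ge0 ?ln_ge0 ?ler1n // lerDr divr_ge0 ?(ltW eps0) //.
  by rewrite !mulr_ge0 // ltW.
rewrite le_eqVlt; apply/orP; left; apply/eqP.
(* The factor 2 comes from rounding [X] up, the power of 4 from [4 * ell / eps]. *)
have -> : 2 ^+ (2 * p.+1 + 1) = 2 * 4 ^+ p.+1 :> R.
  by rewrite addn1 exprS exprM; congr (_ * _ ^+ _); ring.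
rewrite /X /V !exprMn exprVn; ring.
Qed.
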